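(* Let $H$ be a complex separable Hilbert space. Let $B$ be an invertible bounded linear operator on $H$, let $C$ be a compact linear operator on $H$ with singular values $\|C\|=\sigma_1(C)\ge\sigma_2(C)\ge\cdots\ge 0$, and suppose that $A=B+C$ is invertible. Assume that the linear reduction factor of $B$, $$M_B=\sup_{z\in H}\ \sup_{k\in\mathbb{N}}\ \frac{\|r_k^{B,z}\|}{\|r_{k-1}^{B,z}\|},$$ satisfies $M_B<1$. Then for every $r_0\in H$ the GMRES residuals $r_k^{A,r_0}$ fulfill $$\frac{\|r_k^{A,r_0}\|}{\|r_0\|}\le\prod_{j=1}^k\Bigl(M_B+(1+M_B)\,\|A^{-1}\|\,\sigma_j(C)\Bigr)\qquad\text{for all }k\in\mathbb{N}$$ and $$\limsup_{k\to\infty}\frac{\|r_k^{A,r_0}\|}{\|r_{k-1}^{A,r_0}\|}\le M_B .$$ Consequently, if there exists $p\ge 1$ such that $\|C\|_{\mathcal{S}_p}:=\bigl(\sum_{j=1}^\infty\sigma_j(C)^p\bigr)^{1/p}<\infty$, then $$\left(\frac{\|r_k^{A,r_0}\|}{\|r_0\|}\right)^{1/k}\le M_B+k^{-1/p}\,(1+M_B)\,\|A^{-1}\|\,\|C\|_{\mathcal{S}_p}\qquad\text{for all }k\in\mathbb{N}.$$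
   Context: $\|\cdot\|$ denotes both the norm of $H$ and the induced operator norm; $\mathbb{N}=\{1,2,\dots\}$; invertible means having a bounded inverse on $H$. $\mathcal{P}_k$ is the space of complex polynomials of degree at most $k$. GMRES residuals: for a bounded linear operator $T$ on $H$, an initial residual $r_0\in H$ and $k=0,1,2,\dots$, let $\mathcal{K}_k(T,r_0)=\operatorname{span}\{r_0,Tr_0,\dots,T^{k-1}r_0\}$ (so $\mathcal{K}_0=\{0\}$). The $k$-th GMRES residual $r_k^{T,r_0}$ is the element of minimal norm in the affine space $r_0+T\mathcal{K}_k(T,r_0)$; equivalently $r_k^{T,r_0}=b-Tx_k$ where $x_k$ minimizes $\|b-Tx\|$ over $x\in x_0+\mathcal{K}_k(T,r_0)$ and $r_0=b-Tx_0$. Thus $r_0^{T,r_0}=r_0$ and $\|r_k^{T,r_0}\|=\min_{p\in\mathcal{P}_k,\,p(0)=1}\|p(T)r_0\|$. The number $M_B$ is equivalently the best (smallest nonnegative) constant $M$ such that $\|r_k^{B,z}\|\le M\,\|r_{k-1}^{B,z}\|$ for all $k\in\mathbb{N}$ and all $z\in H$. Accordingly, quotients of the form $0/0$ of norms of residuals (which occur once a residual vanishes) are interpreted as $0$. The singular values $\sigma_j(C)$, $j=1,2,\dots$, are listed in nonincreasing order with multiplicity and extended by zeros if there are only finitely many. *)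

(* Defs.v *)
From HB Require Import structures.
From mathcomp Require Import all_boot all_order all_algebra.
From mathcomp Require Import complex.
From mathcomp Require Import all_classical all_reals all_analysis.

Set Implicit Arguments.
Unset Strict Implicit.
Unset Printing Implicit Defensive.

Import Order.TTheory GRing.Theory Num.Theory Num.Def.
Import numFieldNormedType.Exports.

Local Open Scope classical_set_scope.
Local Open Scope ring_scope.

(* A complex Hilbert space: a complete normed R[i]-module whose norm comes from
   a positive definite Hermitian form, linear in its first argument. *)
HB.mixin Record CompleteNormedModule_isHilbert (R : realType) H
    of CompleteNormedModule R[i] H := {
  dotp : {dot H for conjC} ;
  normr_dotp : forall x : H, `|x| ^+ 2 = dotp x x }.

#[short(type="hilbertType")]
HB.structure Definition Hilbert (R : realType) :=
  {H of CompleteNormedModule R[i] H & CompleteNormedModule_isHilbert R H}.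

Section Operators.
Context {R : realType} {H : hilbertType R}.
Implicit Types (T S : H -> H) (x y z e r : H) (k j : nat).

Definition separable_space (X : topologicalType) : Prop :=
  exists2 D : set X, countable D & dense D.

(* The norm `|x| lives in R[i] (it is real there); this is its value in R. *)
Definition nrm x : R := complex.Re `|x|.

Definition bounded_operator T : Prop := bounded_near T (nbhs (0 : H)).

Definition compact_operator T : Prop :=
  precompact (T @` [set x | nrm x <= 1]).

Definition bounded_inverse T (S : {linear H -> H}) : Prop :=
  [/\ bounded_operator S, cancel T S & cancel S T].

Definition invertible_operator T : Prop :=
  exists S : {linear H -> H}, bounded_inverse T S.

Definition opnorm T : R := sup [set nrm (T x) | x in [set x | nrm x <= 1]].

(* The Hilbert adjoint: adjoint T y is the only z with <T x, y> = <x, z> for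
   all x; it exists whenever T is bounded and linear. *)
Definition adjoint T y : H := xget 0 [set z | forall x, dotp (T x) y = dotp x z].

Definition singular_vector T (t : R) e : Prop :=
  0 <= t /\ adjoint T (T e) = (real_complex R (t ^+ 2)) *: e.

(* For j >= 1 and T compact, the j-th entry (counting from 1) of the
   nonincreasing list, with multiplicity, of the square roots of the eigenvalues
   of T^* T: the largest s >= 0 such that at least j of them, counted with
   multiplicity, are >= s.  When T^* T has fewer than j eigenvalues (dim H < j)
   the set is empty and its supremum is 0, which gives the extension by zeros.
   The value at j = 0 is meaningless. *)
Definition singular_value T j : R :=
  sup [set s : R | 0 <= s /\
    exists (t : 'I_j -> R) (e : 'I_j -> H),
      [/\ forall i i' : 'I_j, dotp (e i) (e i') = (i == i')%:R,
          forall i : 'I_j, singular_vector T (t i) (e i)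
        & forall i : 'I_j, s <= t i]].

Definition schatten_norm (p : R) T : \bar R :=
  poweR (\sum_(1 <= j <oo) (singular_value T j `^ p)%:E)%E p^-1.

Definition krylov T r k : set H :=
  [set \sum_(i < k) c i *: iter i T r | c in [set: 'I_k -> R[i]]].

Definition residual_space T r k : set H := [set r + T y | y in krylov T r k].

(* The minimizer exists and is unique, the affine space being of finite
   dimension; the default value 0 is never used for linear T. *)
Definition gmres_residual T r k : H :=
  xget 0 [set s | residual_space T r k s /\
                  forall s', residual_space T r k s' -> nrm s <= nrm s'].

(* Division by 0 yields 0, which is the convention 0 / 0 = 0; the norms of the
   residuals are nonincreasing in k, so no other quotient by 0 arises and all
   the quotients lie in [0, 1]. *)
Definition residual_ratio T r k : R :=
  nrm (gmres_residual T r k) / nrm (gmres_residual T r k.-1).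

Definition reduction_factor T : R :=
  sup [set q | exists r k, (0 < k)%N /\ q = residual_ratio T r k].

End Operators.

(* Main.v *)
Require Import Defs.
From HB Require Import structures.
From mathcomp Require Import all_boot all_order all_algebra.
From mathcomp Require Import complex.
From mathcomp Require Import all_classical all_reals all_analysis.
From mathcomp Require Import ring lra.

Set Implicit Arguments.
Unset Strict Implicit.
Unset Printing Implicit Defensive.

Import Order.TTheory GRing.Theory Num.Theory.
Import numFieldNormedType.Exports.

Local Open Scope classical_set_scope.
Local Open Scope ring_scope.

Local Open Scope complex_scope.

(** Write [M] for the reduction factor of [B] and [F = 1 - b A^-1] with a scalar
    [b] to be chosen.

    Since [A^-1] moves each Krylov vector [A^j r] one place back, [F] acts on the
    family [r, A r, ..., A^k r] (the first vector being kept) as a unitriangular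
    matrix and preserves its Gram determinant. That determinant is [|r_k|^2] times
    the one of [A r, ..., A^k r], because [r_k] is the component of [r] orthogonal
    to [W = A K_k]. Passing to an orthonormal basis [f_1, ..., f_k] of [W] and
    applying Hadamard's inequality gives (gmres_residual_prod)
      [|r_k| <= |r| |F f_1| ... |F f_k|].

    To bound [|F f_j|], the resolvent identity is used in the form
      [F w = (w - b B^-1 w) + A^-1 C (b B^-1 w)].
    One GMRES step for [B] says that each [z] is close to the line of [B z]: the
    sine of their angle is at most [M]. This relation being symmetric, each [w] has
    a scalar [b] with [|w - b B^-1 w| <= M |w|]. By a theorem of Asplund and Ptak
    (uniform_scalar), one scalar then serves the whole of [W]. It also satisfies
    [|b B^-1 w| <= (1 + M) |w|]. Finally the basis is chosen so that [b B^-1 f_j] is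
    orthogonal to the first [j - 1] singular vectors of [C] (exists_flag_basis),
    whence [|C b B^-1 f_j| <= sigma_j(C) (1 + M)] by the spectral theorem for
    [C^* C], which is obtained here in the form singular_value_codim. This proves the
    product bound.

    For the limit superior, let [w_n] be the unit vector of [A K_(n+1)] orthogonal to
    [A K_n]. The ratio of consecutive residuals is at most [|w_n - b A^-1 w_n|] for
    any [b] (gmres_residual_ratio_le), hence at most
    [M + |A^-1| |b_n| |C B^-1 w_n|], and [C B^-1 w_n] tends to 0 because [C] is compact
    and the [w_n] are orthonormal.

    The last bound follows from the first one by comparing the geometric mean with
    the arithmetic mean, and the latter with the [p]-mean. *)

(** * Complex scalars and the inner product *)

Section ComplexModulus.
Context {R : realType}.
Implicit Types (a b : R[i]) (t : R).

Definition cmod a : R := complex.Re `|a|.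

Lemma cmodE a : `|a| = (cmod a)%:C.
Proof. by rewrite /cmod RRe_real // normr_real. Qed.

Lemma cmod_ge0 a : 0 <= cmod a.
Proof. by rewrite -ler0c -cmodE. Qed.

Lemma cmodM a b : cmod (a * b) = cmod a * cmod b.
Proof. by apply: complexI; rewrite -cmodE normrM !cmodE rmorphM. Qed.

Lemma cmod0 : cmod 0 = 0. Proof. by rewrite /cmod normr0. Qed.

Lemma cmod1 : cmod 1 = 1. Proof. by rewrite /cmod normr1. Qed.

Lemma cmodN a : cmod (- a) = cmod a. Proof. by rewrite /cmod normrN. Qed.

Lemma cmod_eq0 a : (cmod a == 0) = (a == 0).
Proof. by rewrite -[a == 0]normr_eq0 cmodE (inj_eq (@complexI R)). Qed.

Lemma cmod_conj a : cmod (Num.conj a) = cmod a.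
Proof. by rewrite /cmod norm_conjC. Qed.

Lemma cmodD a b : cmod (a + b) <= cmod a + cmod b.
Proof. by rewrite -lecR rmorphD /= -!cmodE ler_normD. Qed.

Lemma cmod_real t : cmod t%:C = `|t|.
Proof. by rewrite /cmod normc_def /= expr0n /= addr0 sqrtr_sqr. Qed.

Lemma sqr_cmod a : cmod a ^+ 2 = complex.Re a ^+ 2 + complex.Im a ^+ 2.
Proof. by rewrite /cmod normc_def /= sqr_sqrtr // addr_ge0 // sqr_ge0. Qed.

Lemma mul_conj_cmod a : a * Num.conj a = (cmod a ^+ 2)%:C.
Proof. by rewrite -normCK cmodE rmorphXn. Qed.

Lemma Re_le_cmod a : `|complex.Re a| <= cmod a.
Proof. by rewrite -lecR -cmodE normc_ge_Re. Qed.

Lemma ReD a b : complex.Re (a + b) = complex.Re a + complex.Re b.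
Proof. by case: a; case: b. Qed.

Lemma ReN a : complex.Re (- a) = - complex.Re a.
Proof. by case: a. Qed.

Lemma ReMr t a : complex.Re (t%:C * a) = t * complex.Re a.
Proof. by case: a => x y /=; rewrite mul0r subr0. Qed.

Lemma conj_conjc a : Num.conj a = conjc a.
Proof.
have [->|a0] := eqVneq a 0; first by rewrite rmorph0 conjc0.
by apply: (mulfI a0); rewrite -normCK.
Qed.

Lemma Re_conj a : complex.Re (Num.conj a) = complex.Re a.
Proof. by rewrite conj_conjc; case: a. Qed.

Lemma conj_realc t : Num.conj t%:C = t%:C.
Proof. by rewrite conj_conjc conjc_real. Qed.

End ComplexModulus.

Section InnerProduct.
Context {R : realType} {H : hilbertType R}.
Implicit Types (x y z : H) (a b : R[i]) (t : R).

Definition rdot x y : R := complex.Re (dotp x y).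

Lemma nrmE x : `|x| = (nrm x)%:C.
Proof. by rewrite /nrm RRe_real // normr_real. Qed.

Lemma nrm_ge0 x : 0 <= nrm x.
Proof. by rewrite -ler0c -nrmE. Qed.

Lemma nrm0 : nrm (0 : H) = 0. Proof. by rewrite /nrm normr0. Qed.

Lemma nrmN x : nrm (- x) = nrm x. Proof. by rewrite /nrm normrN. Qed.

Lemma nrm_eq0 x : (nrm x == 0) = (x == 0).
Proof. by rewrite -[x == 0]normr_eq0 nrmE (inj_eq (@complexI R)). Qed.

Lemma nrm_gt0 x : (0 < nrm x) = (x != 0).
Proof. by rewrite lt_def nrm_eq0 nrm_ge0 andbT. Qed.

Lemma nrmZ a x : nrm (a *: x) = cmod a * nrm x.
Proof. by apply: complexI; rewrite -nrmE normrZ nrmE cmodE rmorphM. Qed.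

Lemma nrmD x y : nrm (x + y) <= nrm x + nrm y.
Proof. by rewrite -lecR rmorphD /= -!nrmE ler_normD. Qed.

Lemma nrmB x y : nrm (x - y) <= nrm x + nrm y.
Proof. by rewrite -(nrmN y) nrmD. Qed.

Lemma dotpDl x y z : dotp (x + y) z = dotp x z + dotp y z.
Proof. exact: linearDl. Qed.

Lemma dotpDr x y z : dotp x (y + z) = dotp x y + dotp x z.
Proof. exact: raddfD. Qed.

Lemma dotpZl a x y : dotp (a *: x) y = a * dotp x y.
Proof. exact: linearZl_LR. Qed.

Lemma dotpZr a x y : dotp x (a *: y) = Num.conj a * dotp x y.
Proof. by rewrite linearZr_LR. Qed.

Lemma dotpNl x y : dotp (- x) y = - dotp x y.
Proof. exact: linearNl. Qed.

Lemma dotpNr x y : dotp x (- y) = - dotp x y.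
Proof. exact: raddfN. Qed.

Lemma dotpBl x y z : dotp (x - y) z = dotp x z - dotp y z.
Proof. by rewrite dotpDl dotpNl. Qed.

Lemma dotpBr x y z : dotp x (y - z) = dotp x y - dotp x z.
Proof. by rewrite dotpDr dotpNr. Qed.

Lemma dotp0l y : dotp (0 : H) y = 0.
Proof. exact: linear0l. Qed.

Lemma dotp0r y : dotp y (0 : H) = 0.
Proof. exact: raddf0. Qed.

Lemma dotp_sumr (I : finType) (g : I -> H) x :
  dotp x (\sum_i g i) = \sum_i dotp x (g i).
Proof. exact: raddf_sum. Qed.

Lemma dotpC x y : dotp x y = Num.conj (dotp y x).
Proof. by rewrite hermC expr0 mul1r. Qed.

Lemma dotp_suml (I : finType) (g : I -> H) x :
  dotp (\sum_i g i) x = \sum_i dotp (g i) x.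
Proof.
rewrite dotpC dotp_sumr rmorph_sum; apply: eq_bigr => i _.
by rewrite [RHS]dotpC.
Qed.

Lemma dotp_eq0C x y : dotp x y = 0 -> dotp y x = 0.
Proof. by move=> xy0; rewrite dotpC xy0 rmorph0. Qed.

Lemma dotpp x : dotp x x = (nrm x ^+ 2)%:C.
Proof. by rewrite -normr_dotp nrmE rmorphXn. Qed.

Lemma rdotpp x : rdot x x = nrm x ^+ 2.
Proof. by rewrite /rdot dotpp. Qed.

Lemma rdotDl x y z : rdot (x + y) z = rdot x z + rdot y z.
Proof. by rewrite /rdot dotpDl ReD. Qed.

Lemma rdotDr x y z : rdot x (y + z) = rdot x y + rdot x z.
Proof. by rewrite /rdot dotpDr ReD. Qed.

Lemma rdotNr x y : rdot x (- y) = - rdot x y.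
Proof. by rewrite /rdot dotpNr ReN. Qed.

Lemma rdotZr t x y : rdot x (t%:C *: y) = t * rdot x y.
Proof. by rewrite /rdot dotpZr conj_realc ReMr. Qed.

Lemma rdotC x y : rdot x y = rdot y x.
Proof. by rewrite /rdot dotpC Re_conj. Qed.

Lemma sqr_nrmD x y : nrm (x + y) ^+ 2 = nrm x ^+ 2 + 2 * rdot x y + nrm y ^+ 2.
Proof. by rewrite -!rdotpp !rdotDl !rdotDr (rdotC y x); ring. Qed.

Lemma sqr_nrmB x y : nrm (x - y) ^+ 2 = nrm x ^+ 2 - 2 * rdot x y + nrm y ^+ 2.
Proof. by rewrite sqr_nrmD nrmN rdotNr mulrN. Qed.

Lemma sqr_nrm_pythag x y :
  dotp x y = 0 -> nrm (x + y) ^+ 2 = nrm x ^+ 2 + nrm y ^+ 2.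
Proof. by move=> xy0; rewrite sqr_nrmD /rdot xy0 mulr0 addr0. Qed.

Lemma sqr_nrmBZ a x y :
  nrm (x - a *: y) ^+ 2 =
  nrm x ^+ 2 - 2 * complex.Re (Num.conj a * dotp x y) + cmod a ^+ 2 * nrm y ^+ 2.
Proof. by rewrite sqr_nrmB /rdot dotpZr nrmZ exprMn. Qed.

(** The left-hand side is the squared distance from [x] to the line of [y]: the
    coefficient is that of the orthogonal projection. *)
Lemma sqr_nrm_proj x y : y != 0 ->
  nrm (x - (dotp x y / dotp y y) *: y) ^+ 2 =
  nrm x ^+ 2 - cmod (dotp x y) ^+ 2 / nrm y ^+ 2.
Proof.
move=> y0; have ny0 : nrm y != 0 by rewrite nrm_eq0.
have -> : dotp x y / dotp y y = ((nrm y ^+ 2)^-1)%:C * dotp x y.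
  by rewrite dotpp fmorphV mulrC.
rewrite sqr_nrmBZ rmorphM /= conj_realc -mulrA [Num.conj _ * dotp x y]mulrC.
rewrite mul_conj_cmod ReMr cmodM cmod_real /=.
rewrite [`|_|]ger0_norm ?invr_ge0 ?sqr_ge0 //.
by field.
Qed.

Lemma sqr_nrm_proj_le a x y : y != 0 ->
  nrm x ^+ 2 - cmod (dotp x y) ^+ 2 / nrm y ^+ 2 <= nrm (x - a *: y) ^+ 2.
Proof.
move=> y0; rewrite -sqr_nrm_proj //; set c := dotp x y / dotp y y.
have -> : x - a *: y = (x - c *: y) + (c - a) *: y.
  by rewrite scalerBl addrA subrK.
rewrite (@sqr_nrm_pythag (x - c *: y)) ?lerDl ?sqr_ge0 //.
rewrite dotpZr dotpBl dotpZl divfK ?subrr ?mulr0 //.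
by rewrite dotpp fmorph_eq0 sqrf_eq0 nrm_eq0.
Qed.

Lemma CauchySchwarz x y : cmod (dotp x y) <= nrm x * nrm y.
Proof.
have [->|y0] := eqVneq y 0; first by rewrite dotp0r cmod0 nrm0 mulr0.
have ny0 : 0 < nrm y by rewrite nrm_gt0.
rewrite -(ler_pXn2r (n := 2)) ?nnegrE ?cmod_ge0 ?mulr_ge0 ?nrm_ge0 //.
rewrite exprMn -ler_pdivrMr ?exprn_gt0 // -subr_ge0 -sqr_nrm_proj //.
exact: sqr_ge0.
Qed.

Lemma rdot_le x y : `|rdot x y| <= nrm x * nrm y.
Proof. exact: le_trans (Re_le_cmod _) (CauchySchwarz _ _). Qed.

(** For nonzero [x] and [y] both inequalities say that the sine of their angle is
    at most [M]. *)
Lemma near_collinear_sym (M : R) x y : 0 <= M -> x != 0 ->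
  (exists a, nrm (x - a *: y) <= M * nrm x) ->
  exists b, nrm (y - b *: x) <= M * nrm y.
Proof.
move=> M0 x0 [a xay].
have [y0|y0] := eqVneq y 0.
  by exists 0; rewrite y0 scale0r subr0 nrm0 mulr0.
have nx0 : 0 < nrm x ^+ 2 by rewrite exprn_gt0 // nrm_gt0.
have ny0 : 0 < nrm y ^+ 2 by rewrite exprn_gt0 // nrm_gt0.
exists (dotp y x / dotp x x).
rewrite -(ler_pXn2r (n := 2)) ?nnegrE ?mulr_ge0 ?nrm_ge0 //.
rewrite sqr_nrm_proj // dotpC cmod_conj exprMn.
have : nrm x ^+ 2 - cmod (dotp x y) ^+ 2 / nrm y ^+ 2 <= (M * nrm x) ^+ 2.
  apply: le_trans (sqr_nrm_proj_le a x y0) _.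
  by rewrite ler_pXn2r // ?nnegrE ?mulr_ge0 ?nrm_ge0.
rewrite exprMn !lerBlDr -!lerBlDl ler_pdivlMr // => le.
rewrite ler_pdivlMr //.
by move: le; set u := cmod _ ^+ 2; lra.
Qed.

Lemma cmod_inv_nrm x : cmod (nrm x)^-1%:C = (nrm x)^-1.
Proof. by rewrite cmod_real ger0_norm // invr_ge0 nrm_ge0. Qed.

Lemma nrm_normalize x : x != 0 -> nrm ((nrm x)^-1%:C *: x) = 1.
Proof. by move=> x0; rewrite nrmZ cmod_inv_nrm mulVf // nrm_eq0. Qed.

Lemma homogeneous_bound (T : {linear H -> H}) (V : set H) (s : R) :
  (forall a x, V x -> V (a *: x)) ->
  (forall x, V x -> nrm x = 1 -> nrm (T x) <= s) ->
  forall x, V x -> nrm (T x) <= s * nrm x.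
Proof.
move=> VZ Ts x Vx; have [->|x0] := eqVneq x 0.
  by rewrite linear0 !nrm0 mulr0.
rewrite -ler_pdivrMr ?nrm_gt0 // mulrC -cmod_inv_nrm -nrmZ -linearZ.
by apply: Ts; [exact: VZ | exact: nrm_normalize].
Qed.

End InnerProduct.

(** * Finite families, spans and orthogonal projections *)

Section Families.
Context {R : realType} {H : hilbertType R}.
Implicit Types (x y z e : H) (a : R[i]) (k m : nat) (es : seq H).

Definition lincomb k (c : 'I_k -> R[i]) (v : 'I_k -> H) : H :=
  \sum_i c i *: v i.

Definition spanned k (v : 'I_k -> H) : set H :=
  [set lincomb c v | c in [set: 'I_k -> R[i]]].

Definition orthonormal_family k (f : 'I_k -> H) : Prop :=
  forall i j, dotp (f i) (f j) = (i == j)%:R.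

Definition fcons k x (v : 'I_k -> H) (i : 'I_k.+1) : H :=
  if unlift ord0 i is Some j then v j else x.

Lemma fcons0 k x (v : 'I_k -> H) : fcons x v ord0 = x.
Proof. by rewrite /fcons unlift_none. Qed.

Lemma fcons_lift k x (v : 'I_k -> H) i : fcons x v (lift ord0 i) = v i.
Proof. by rewrite /fcons liftK. Qed.

Lemma fconsK k (w : 'I_k.+1 -> H) :
  fcons (w ord0) (fun i => w (lift ord0 i)) = w.
Proof. by apply/funext => i; rewrite /fcons; case: unliftP => [j|] ->. Qed.

Lemma spannedD k (v : 'I_k -> H) x y :
  spanned v x -> spanned v y -> spanned v (x + y).
Proof.
move=> [c _ <-] [d _ <-]; exists (fun i => c i + d i) => //.
by rewrite /lincomb -big_split; apply: eq_bigr => i _; rewrite scalerDl.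
Qed.

Lemma spannedZ k (v : 'I_k -> H) a x : spanned v x -> spanned v (a *: x).
Proof.
move=> [c _ <-]; exists (fun i => a * c i) => //.
by rewrite /lincomb scaler_sumr; apply: eq_bigr => i _; rewrite scalerA.
Qed.

Lemma spannedB k (v : 'I_k -> H) x y :
  spanned v x -> spanned v y -> spanned v (x - y).
Proof. by move=> vx vy; rewrite -scaleN1r; exact/spannedD/spannedZ. Qed.

Lemma spanned0 k (v : 'I_k -> H) : spanned v 0.
Proof.
by exists (fun=> 0) => //; rewrite /lincomb big1 // => i _; rewrite scale0r.
Qed.

Lemma spanned_mem k (v : 'I_k -> H) i : spanned v (v i).
Proof.
exists (fun j => (j == i)%:R) => //.
rewrite /lincomb (bigD1 i) //= eqxx scale1r big1 ?addr0 // => j /negbTE ->.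
by rewrite scale0r.
Qed.

Lemma spanned_sub k m (v : 'I_k -> H) (w : 'I_m -> H) :
  (forall i, spanned w (v i)) -> spanned v `<=` spanned w.
Proof.
move=> vw _ [c _ <-]; rewrite /lincomb; elim/big_rec: _ => [|i x _ wx].
  exact: spanned0.
exact/spannedD/wx/spannedZ/vw.
Qed.

Lemma dotp_spanned k (v : 'I_k -> H) x y :
  (forall i, dotp x (v i) = 0) -> spanned v y -> dotp x y = 0.
Proof.
move=> xv [c _ <-]; rewrite dotp_sumr big1 // => i _.
by rewrite dotpZr xv mulr0.
Qed.

Lemma orthogonal_projection k (v : 'I_k -> H) x :
  exists2 y, spanned v y & forall i, dotp (x - y) (v i) = 0.
Proof.
elim: k v x => [|k IHk] v x; first by exists 0; [exact: spanned0 | case].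
pose v' i := v (lift ord0 i).
have v'v : spanned v' `<=` spanned v by apply: spanned_sub => i; exact: spanned_mem.
have [p v'p p_orth] := IHk v' (v ord0).
have [y v'y y_orth] := IHk v' x.
pose q := v ord0 - p.
have vq : spanned v q by apply: spannedB; [exact: spanned_mem | exact: v'v].
have [q0|q0] := eqVneq q 0.
  exists y => [|i]; first exact: v'v.
  case: (unliftP ord0 i) => [j|] ->; first exact: y_orth.
  by apply: (dotp_spanned y_orth); rewrite -[v ord0](subrK p) -/q q0 add0r.
pose c := dotp (x - y) q / dotp q q; exists (y + c *: q).
  by apply: spannedD; [exact: v'v | exact: spannedZ].
have qq : dotp q q != 0 by rewrite dotpp fmorph_eq0 expf_eq0 /= nrm_eq0.
have orth_v' i : dotp (x - (y + c *: q)) (v' i) = 0.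
  by rewrite opprD addrA dotpBl y_orth dotpZl p_orth mulr0 subr0.
move=> i; case: (unliftP ord0 i) => [j|] ->; first exact: orth_v'.
rewrite -[v ord0](subrK p) -/q dotpDr (dotp_spanned orth_v' v'p) addr0.
by rewrite opprD addrA [LHS]dotpBl dotpZl divfK // subrr.
Qed.

Lemma nrm_orthonormal k (f : 'I_k -> H) i :
  orthonormal_family f -> nrm (f i) = 1.
Proof.
move=> fo; apply/eqP; rewrite -(eqrXn2 (n := 2)) ?nrm_ge0 // expr1n.
by apply/eqP/complexI; rewrite -dotpp fo eqxx.
Qed.

Lemma dotp_lincomb_orthonormal k (f : 'I_k -> H) c i :
  orthonormal_family f -> dotp (lincomb c f) (f i) = c i.
Proof.
move=> fo; rewrite dotp_suml (bigD1 i) //= dotpZl fo eqxx mulr1.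
by rewrite big1 ?addr0 // => j /negbTE ji; rewrite dotpZl fo ji mulr0.
Qed.

(** Parseval's identity. *)
Lemma sqr_nrm_lincomb k (f : 'I_k -> H) c :
  orthonormal_family f -> nrm (lincomb c f) ^+ 2 = \sum_i cmod (c i) ^+ 2.
Proof.
move=> fo; apply: complexI; rewrite -dotpp {2}/lincomb dotp_sumr rmorph_sum.
apply: eq_bigr => i _.
by rewrite dotpZr dotp_lincomb_orthonormal // mulrC mul_conj_cmod.
Qed.

Lemma fcons_orthonormal k (f : 'I_k -> H) e : orthonormal_family f ->
  nrm e = 1 -> (forall i, dotp e (f i) = 0) -> orthonormal_family (fcons e f).
Proof.
move=> fo ne ef i j.
case: (unliftP ord0 i) => [i'|] ->; case: (unliftP ord0 j) => [j'|] ->;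
  rewrite ?fcons_lift ?fcons0 ?eqxx.
- by rewrite fo (inj_eq lift_inj).
- by rewrite dotp_eq0C.
- by rewrite ef.
- by rewrite dotpp ne expr1n.
Qed.

Definition orthogonal_to es : set H := [set x | {in es, forall e, dotp x e = 0}].

Lemma orthogonal_toD es x y :
  orthogonal_to es x -> orthogonal_to es y -> orthogonal_to es (x + y).
Proof. by move=> ox oy e e_in; rewrite dotpDl ox // oy // addr0. Qed.

Lemma orthogonal_toZ es a x : orthogonal_to es x -> orthogonal_to es (a *: x).
Proof. by move=> ox e e_in; rewrite dotpZl ox // mulr0. Qed.

Lemma orthogonal_to_codom k (f : 'I_k -> H) x :
  orthogonal_to (codom f) x <-> forall i, dotp x (f i) = 0.
Proof.
split=> [ox i|xf _ /codomP[i ->]]; last exact: xf.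
by apply: ox; exact: codom_f.
Qed.

End Families.

(** * Gram determinants *)

Section GramDeterminants.
Context {R : realType} {H : hilbertType R}.
Implicit Types (x y z : H) (a : R[i]) (k m : nat).

Definition gram k (v : 'I_k -> H) : 'M[R[i]]_k := \matrix_(i, j) dotp (v i) (v j).

Definition mxfam m k (T : 'M[R[i]]_(m, k)) (v : 'I_k -> H) (i : 'I_m) : H :=
  lincomb (T i) v.

Lemma gram_mxfam m k (T : 'M[R[i]]_(m, k)) (v : 'I_k -> H) :
  gram (mxfam T v) = T *m gram v *m (map_mx Num.conj T)^T.
Proof.
apply/matrixP => i j; rewrite !mxE /mxfam dotp_sumr; apply: eq_bigr => l _.
rewrite dotpZr dotp_suml !mxE mulrC; congr (_ * _); apply: eq_bigr => l' _.
by rewrite dotpZl !mxE.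
Qed.

Lemma det_gram_mxfam k (T : 'M[R[i]]_k) (v : 'I_k -> H) :
  \det (gram (mxfam T v)) = (cmod (\det T) ^+ 2)%:C * \det (gram v).
Proof.
rewrite gram_mxfam !det_mulmx det_tr det_map_mx -mul_conj_cmod.
by rewrite mulrAC.
Qed.

Lemma block_mx1E k (A : 'M[R[i]]_1) (c : 'rV[R[i]]_k) (d : 'cV[R[i]]_k)
    (T : 'M[R[i]]_k) (P := block_mx A c d T : 'M[R[i]]_k.+1) :
  [/\ P ord0 ord0 = A 0 0, forall j, P ord0 (lift ord0 j) = c 0 j,
      forall i, P (lift ord0 i) ord0 = d i 0 &
      forall i j, P (lift ord0 i) (lift ord0 j) = T i j].
Proof.
have e0 : ord0 = lshift k ord0 :> 'I_(1 + k) by exact/val_inj.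
have eS l : lift ord0 l = rshift 1 l :> 'I_(1 + k) by exact/val_inj.
split=> [|j|i|i j]; rewrite /P ?eS ?e0.
- exact: (block_mxEul A c d T).
- exact: (block_mxEur A c d T).
- exact: (block_mxEdl A c d T).
- exact: (block_mxEdr A c d T).
Qed.

Lemma det_block1 k (A : 'M[R[i]]_1) (c : 'rV[R[i]]_k) (T : 'M[R[i]]_k) :
  \det (block_mx A c 0 T : 'M[R[i]]_k.+1) = A 0 0 * \det T.
Proof. by rewrite -(det_mx11 A); exact: (det_ublock A c T). Qed.

Lemma mxfam_fcons k (a : R[i]) (c : 'rV[R[i]]_k) (d : 'cV[R[i]]_k)
    (T : 'M[R[i]]_k) x (v : 'I_k -> H) :
  mxfam (block_mx (a%:M : 'M[R[i]]_1) c d T : 'M[R[i]]_k.+1) (fcons x v) =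
  fcons (a *: x + lincomb (c 0) v) (fun i => d i 0 *: x + mxfam T v i).
Proof.
have [P00 P0S PS0 PSS] := block_mx1E a%:M c d T.
apply/funext => i; rewrite /mxfam /lincomb big_ord_recl fcons0.
case: (unliftP ord0 i) => [j|] ->.
  rewrite PS0 fcons_lift; congr (_ + _).
  by apply: eq_bigr => l _; rewrite PSS fcons_lift.
rewrite fcons0 P00 mxE eqxx mulr1n; congr (_ + _).
by apply: eq_bigr => l _; rewrite P0S fcons_lift.
Qed.

Lemma det_gram_fcons_mxfam k (T : 'M[R[i]]_k) x (v : 'I_k -> H) :
  \det (gram (fcons x (mxfam T v))) =
  (cmod (\det T) ^+ 2)%:C * \det (gram (fcons x v)).
Proof.
have -> : fcons x (mxfam T v) =
    mxfam (block_mx (1%:M : 'M[R[i]]_1) 0 0 T : 'M[R[i]]_k.+1) (fcons x v).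
  rewrite mxfam_fcons; congr fcons.
    rewrite scale1r /lincomb big1 ?addr0 // => i _.
    by rewrite mxE scale0r.
  by apply/funext => i; rewrite mxE scale0r add0r.
by rewrite det_gram_mxfam det_block1 mxE eqxx mul1r.
Qed.

Lemma det_gram_fconsB k x y (v : 'I_k -> H) : spanned v y ->
  \det (gram (fcons (x - y) v)) = \det (gram (fcons x v)).
Proof.
move=> [c _ <-].
have -> : fcons (x - lincomb c v) v =
    mxfam (block_mx (1%:M : 'M[R[i]]_1) (\row_j - c j) 0 1%:M : 'M[R[i]]_k.+1)
      (fcons x v).
  rewrite mxfam_fcons; congr fcons.
    rewrite scale1r; congr (_ + _); rewrite /lincomb -sumrN.
    by apply: eq_bigr => i _; rewrite mxE scaleNr.
  apply/funext => i; rewrite mxE scale0r add0r /mxfam /lincomb.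
  rewrite (bigD1 i) //= mxE eqxx scale1r big1 ?addr0 // => j ji.
  by rewrite mxE eq_sym (negbTE ji) scale0r.
by rewrite det_gram_mxfam det_block1 mxE eqxx det1 mul1r cmod1 expr1n mul1r.
Qed.

Lemma det_gram_fcons_orth k x (v : 'I_k -> H) :
  (forall i, dotp x (v i) = 0) ->
  \det (gram (fcons x v)) = (nrm x ^+ 2)%:C * \det (gram v).
Proof.
move=> xv.
have [P00 P0S PS0 PSS] := block_mx1E (dotp x x)%:M 0 0 (gram v).
have -> : gram (fcons x v) =
    block_mx ((dotp x x)%:M : 'M[R[i]]_1) 0 0 (gram v) :> 'M[R[i]]_k.+1.
  apply/matrixP => i j; rewrite [LHS]mxE.
  case: (unliftP ord0 i) => [i'|] ->; case: (unliftP ord0 j) => [j'|] ->;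
    rewrite ?PSS ?P0S ?PS0 ?P00 ?fcons_lift ?fcons0 mxE ?eqxx //.
  exact: dotp_eq0C.
by rewrite det_block1 mxE eqxx dotpp.
Qed.

(** Hadamard's inequality: by Gram-Schmidt the Gram determinant is the product
    of the squared distances of each vector to the span of the later ones. *)
Lemma Hadamard k (v : 'I_k -> H) :
  0 <= \det (gram v) <= (\prod_i nrm (v i) ^+ 2)%:C.
Proof.
elim: k v => [|k IHk] v; first by rewrite det_mx00 big_ord0 ler01 lexx.
rewrite -(fconsK v); set x := v ord0; set v' := fun i => _.
have [y v'y xy] := orthogonal_projection v' x.
rewrite -(det_gram_fconsB _ v'y) det_gram_fcons_orth //.
have /andP[g0 g1] := IHk v'.
rewrite mulr_ge0 ?ler0c ?sqr_ge0 // andTb big_ord_recl fcons0.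
rewrite (eq_bigr (fun i => nrm (v' i) ^+ 2)); last first.
  by move=> i _; rewrite fcons_lift.
rewrite [X in _ <= X]rmorphM; apply: ler_pM => //; rewrite ?ler0c ?sqr_ge0 // lecR.
have xy0 : dotp (x - y) y = 0 by exact: dotp_spanned xy v'y.
by rewrite -[X in _ <= nrm X ^+ 2](subrK y) (sqr_nrm_pythag xy0) lerDl sqr_ge0.
Qed.

Lemma gram_orthonormal k (f : 'I_k -> H) :
  orthonormal_family f -> gram f = 1%:M.
Proof. by move=> fo; apply/matrixP => i j; rewrite !mxE fo. Qed.

Lemma det_gram_eq0 k (v : 'I_k -> H) : \det (gram v) = 0 ->
  exists2 c : 'I_k -> R[i], exists i, c i != 0 & lincomb c v = 0.
Proof.
move=> /eqP/det0P[c c0 cG]; exists (c 0).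
  apply/existsP; apply: contra_neqT c0 => /existsPn c0.
  by apply/rowP => i; rewrite mxE; have := c0 i; rewrite negbK => /eqP.
apply/eqP; rewrite -nrm_eq0 -sqrf_eq0; apply/eqP/complexI.
have := gram_mxfam c v; rewrite cG mul0mx => /matrixP/(_ 0 0).
by rewrite !mxE dotpp => ->.
Qed.

End GramDeterminants.

(** * GMRES residuals and the reduction factor *)

Section GMRES.
Context {R : realType} {H : hilbertType R}.
Implicit Types (T : {linear H -> H}) (r x y z : H) (a : R[i]) (k m : nat).

Lemma linear_lincomb T k (c : 'I_k -> R[i]) (v : 'I_k -> H) :
  T (lincomb c v) = lincomb c (fun i => T (v i)).
Proof. by rewrite /lincomb linear_sum; apply: eq_bigr => i _; rewrite linearZ. Qed.

(** The shifted Krylov vectors [T r, ..., T^k r], which span [T K_k(T, r)]. *)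
Definition krylov_image (T : H -> H) r k (i : 'I_k) : H := iter i.+1 T r.

Lemma krylov_image_sub (T : H -> H) r k m : (k <= m)%N ->
  spanned (krylov_image T r (k := k)) `<=` spanned (krylov_image T r (k := m)).
Proof.
move=> km; apply: spanned_sub => i.
exact: (spanned_mem _ (widen_ord km i)).
Qed.

Lemma residual_spaceP T r k s : residual_space T r k s <->
  exists2 y, spanned (krylov_image T r (k := k)) y & s = r - y.
Proof.
split=> [[x [c _ <-] <-]|[y ky ->]].
  exists (- T (\sum_(i < k) c i *: iter i T r)); last by rewrite opprK.
  rewrite -scaleN1r; apply: spannedZ; exists c => //.
  exact/esym/(linear_lincomb T c (fun i : 'I_k => iter i T r)).
have [c _ <-] := ky; exists (\sum_(i < k) - c i *: iter i T r).
  by exists (fun i => - c i).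
rewrite linear_sum -sumrN; congr (_ + _); apply: eq_bigr => i _.
by rewrite linearZ /= scaleNr.
Qed.

Lemma residual_space_ge T r k y z :
  spanned (krylov_image T r (k := k)) y ->
  (forall i, dotp (r - y) (krylov_image T r (k := k) i) = 0) ->
  spanned (krylov_image T r (k := k)) z ->
  nrm (r - z) ^+ 2 = nrm (r - y) ^+ 2 + nrm (y - z) ^+ 2.
Proof.
move=> ky r_orth kz; rewrite -[r - z](subrKA y).
exact/sqr_nrm_pythag/(dotp_spanned r_orth (spannedB ky kz)).
Qed.

Lemma gmres_residual_mem T r k :
  residual_space T r k (gmres_residual T r k) /\
  forall s, residual_space T r k s -> nrm (gmres_residual T r k) <= nrm s.
Proof.
have [y ky y_orth] := orthogonal_projection (krylov_image T r (k := k)) r.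
apply: (@xgetPex _ 0 [set s | residual_space T r k s /\
                  forall s', residual_space T r k s' -> nrm s <= nrm s']).
exists (r - y); split; first by apply/residual_spaceP; exists y.
move=> _ /residual_spaceP[z kz ->].
rewrite -(ler_pXn2r (n := 2)) ?nnegrE ?nrm_ge0 //.
by rewrite (residual_space_ge ky y_orth kz) lerDl sqr_ge0.
Qed.

Lemma gmres_residual_min T r k y : spanned (krylov_image T r (k := k)) y ->
  nrm (gmres_residual T r k) <= nrm (r - y).
Proof.
by move=> ky; apply: (gmres_residual_mem T r k).2; apply/residual_spaceP; exists y.
Qed.

(** By Pythagoras the orthogonal residual is strictly shorter than any other
    element of the residual space. *)
Lemma gmres_residualP T r k :
  exists2 y, spanned (krylov_image T r (k := k)) y
  & gmres_residual T r k = r - y /\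
    forall i, dotp (gmres_residual T r k) (krylov_image T r (k := k) i) = 0.
Proof.
have [/residual_spaceP[z kz rzE] _] := gmres_residual_mem T r k.
have [y ky y_orth] := orthogonal_projection (krylov_image T r (k := k)) r.
have := gmres_residual_min ky; rewrite rzE.
rewrite -(ler_pXn2r (n := 2)) ?nnegrE ?nrm_ge0 //.
rewrite (residual_space_ge ky y_orth kz) gerDl => yz.
exists z => //; split => // i.
suff <- : y = z by [].
by apply/eqP; rewrite -subr_eq0 -nrm_eq0 -sqrf_eq0 eq_le yz sqr_ge0.
Qed.

Lemma gmres_residual0 T r : gmres_residual T r 0 = r.
Proof.
have [y [c _ <-] [-> _]] := gmres_residualP T r 0.
by rewrite /lincomb big_ord0 subr0.
Qed.

Lemma gmres_residual_noninc T r k m : (k <= m)%N ->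
  nrm (gmres_residual T r m) <= nrm (gmres_residual T r k).
Proof.
move=> km; have [y ky [-> _]] := gmres_residualP T r k.
exact/gmres_residual_min/(krylov_image_sub km).
Qed.

Lemma residual_ratio_ge0 T r k : 0 <= residual_ratio T r k.
Proof. by rewrite /residual_ratio divr_ge0 ?nrm_ge0. Qed.

Lemma residual_ratio_le1 T r k : residual_ratio T r k <= 1.
Proof.
rewrite /residual_ratio; have [->|r0] := eqVneq (nrm (gmres_residual T r k.-1)) 0.
  by rewrite invr0 mulr0.
rewrite ler_pdivrMr ?mul1r ?gmres_residual_noninc ?leq_pred //.
by rewrite lt_def r0 nrm_ge0.
Qed.

Lemma residual_ratio_le T r k : (0 < k)%N ->
  residual_ratio T r k <= reduction_factor T.
Proof.
move=> k0; apply: ub_le_sup; last by exists r, k.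
by exists 1 => _ [z [j [_ ->]]]; exact: residual_ratio_le1.
Qed.

Lemma reduction_factor_ge0 T : 0 <= reduction_factor T.
Proof. exact: le_trans (residual_ratio_ge0 _ 0 1) (residual_ratio_le _ _ _). Qed.

(** The first residual of [z] is [z - a T z] for the best [a], so this is the
    case [k = 1] of the supremum. *)
Lemma reduction_factor_step T z :
  exists a, nrm (z - a *: T z) <= reduction_factor T * nrm z.
Proof.
have [_ [c _ <-] [rE _]] := gmres_residualP T z 1.
exists (c ord0).
have -> : z - c ord0 *: T z = gmres_residual T z 1.
  by rewrite rE /lincomb big_ord1.
have [->|z0] := eqVneq z 0.
  have := gmres_residual_noninc T (0 : H) (leq0n 1).
  by rewrite gmres_residual0 nrm0 mulr0.
rewrite -ler_pdivrMr ?nrm_gt0 //.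
by have := residual_ratio_le T z (ltn0Sn 0); rewrite /residual_ratio gmres_residual0.
Qed.

End GMRES.

(** * The residual as a Gram determinant *)

Section KrylovDeterminant.
Context {R : realType} {H : hilbertType R}.
Variables (A Ainv : {linear H -> H}).
Hypothesis AK : cancel A Ainv.
Implicit Types (r x y z : H) (b : R[i]) (k m : nat).

Lemma gmres_residual_eq0 r k :
  spanned (krylov_image A r (k := k)) r -> gmres_residual A r k = 0.
Proof.
move=> /gmres_residual_min; rewrite subrr nrm0 => r0.
by apply/eqP; rewrite -nrm_eq0 eq_le r0 nrm_ge0.
Qed.

(** A linear relation between the Krylov vectors, read from its first nonzero
    coefficient on and pulled back by a power of [A^-1], expresses the initial
    residual through [A K_k]. *)
Lemma krylov_dependent r k :
  \det (gram (krylov_image A r (k := k))) = 0 -> gmres_residual A r k = 0.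
Proof.
move=> /det_gram_eq0[c [i0 ci0] c_rel]; apply: gmres_residual_eq0.
have [i ci i_min] := @arg_minnP _ i0 (fun i => c i != 0) val ci0.
have pull (n : nat) x : iter n Ainv (iter n A x) = x.
  by elim: n x => // n IHn x; rewrite iterSr AK IHn.
have iterL n : exists T : {linear H -> H}, iter n Ainv =1 T.
  elim: n => [|n [T TE]]; first by exists idfun.
  by exists (Ainv \o T) => x /=; rewrite TE.
have [T TE] := iterL i.+1.
have /(congr1 T) := c_rel; rewrite linear0 linear_lincomb.
rewrite /lincomb (bigD1 i) //= -TE pull => /(canRL (addrK _)) rE.
suff /(spannedZ (c i)^-1) : spanned (krylov_image A r (k := k)) (c i *: r).
  by rewrite scalerA mulVf // scale1r.
rewrite rE sub0r -scaleN1r; apply: spannedZ.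
elim/big_ind: _ => [|x y|j ji]; [exact: spanned0|exact: spannedD|].
have [->|cj] := eqVneq (c j) 0; first by rewrite scale0r; exact: spanned0.
apply: spannedZ.
have ij : (i < j)%N by rewrite ltn_neqAle eq_sym ji i_min.
have ltk : ((j - i).-1 < k)%N.
  by rewrite prednK ?subn_gt0 // (leq_trans (leq_subr _ _)) // ltnW.
have -> : krylov_image A r j = iter i.+1 A (krylov_image A r (Ordinal ltk)).
  rewrite /krylov_image -iterD; congr (iter _ A r) => /=.
  by rewrite prednK ?subn_gt0 // addSn subnKC // ltnW.
rewrite -TE pull; exact: spanned_mem.
Qed.

(** [A^-1] moves each Krylov vector one place back, so the change of family is
    unitriangular. *)
Lemma det_gram_krylov_shift b r k (v := krylov_image A r (k := k)) :
  \det (gram (fcons r (fun i => v i - b *: Ainv (v i)))) =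
  \det (gram (fcons r v)).
Proof.
pose w (i : 'I_k.+1) := iter i A r.
have -> : fcons r v = w by rewrite -(fconsK w).
pose L : 'M[R[i]]_k.+1 := \matrix_(i, j) ((i == j)%:R - b * (j.+1 == i)%:R).
have -> : fcons r (fun i => v i - b *: Ainv (v i)) = mxfam L w.
  apply/funext => i.
  have -> : mxfam L w i = w i - b *: \sum_(j < k.+1) (j.+1 == i)%:R *: w j.
    have -> : w i = \sum_j (i == j)%:R *: w j.
      rewrite (bigD1 i) //= eqxx scale1r big1 ?addr0 // => j ji.
      by rewrite eq_sym (negbTE ji) scale0r.
    rewrite /mxfam /lincomb scaler_sumr -sumrB; apply: eq_bigr => j _.
    by rewrite mxE scalerBl scalerA.
  case: (unliftP ord0 i) => [j|] ->.
    rewrite fcons_lift (bigD1 (widen_ord (leqnSn k) j)) //= eqxx scale1r.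
    rewrite big1 ?addr0 => [|l lj].
      by rewrite /v /krylov_image iterS AK.
    have [[lj']|_] := eqVneq l.+1 (lift ord0 j : nat); last by rewrite scale0r.
    by case/eqP: lj; exact/val_inj.
  rewrite fcons0 big1 ?scaler0 ?subr0 // => j _.
  by rewrite scale0r.
rewrite det_gram_mxfam det_trig.
  rewrite big1 ?cmod1 ?expr1n ?mul1r // => i _.
  by rewrite mxE eqxx gtn_eqF ?mulr0 ?subr0.
apply/is_trig_mxP => i j ij; rewrite mxE -val_eqE /= (ltn_eqF ij).
by rewrite gtn_eqF ?mulr0 ?subr0 // ltnS ltnW.
Qed.

(** With [F = 1 - b A^-1] and [f = T v], the determinant [det G(r, F f)] equals
    [|det T|^2 det G(r, v)] because [F] is unitriangular on the Krylov vectors [v],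
    and the latter is [|det T|^2 |r_k|^2 det G(v) = |r_k|^2 det G(f) = |r_k|^2].
    Hadamard's inequality bounds the former. *)
Lemma gmres_residual_prod b r k (T : 'M[R[i]]_k)
    (f := mxfam T (krylov_image A r (k := k))) :
  orthonormal_family f ->
  nrm (gmres_residual A r k) <= nrm r * \prod_i nrm (f i - b *: Ainv (f i)).
Proof.
move=> fo; set v := krylov_image A r (k := k) in f fo *.
have FfE : (fun i => f i - b *: Ainv (f i)) =
    mxfam T (fun i => v i - b *: Ainv (v i)).
  apply/funext => i; rewrite /f /mxfam linear_lincomb /lincomb scaler_sumr -sumrB.
  by apply: eq_bigr => j _; rewrite scalerBr !scalerA mulrC.
have [y vy [rkE rk_orth]] := gmres_residualP A r k.
have := Hadamard (fcons r (fun i => f i - b *: Ainv (f i))).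
rewrite {1 2}FfE => /andP[_].
rewrite det_gram_fcons_mxfam det_gram_krylov_shift -(det_gram_fconsB _ vy) -rkE.
rewrite det_gram_fcons_orth // mulrCA -det_gram_mxfam -/f gram_orthonormal //.
rewrite det1 mulr1 lecR big_ord_recl fcons0.
rewrite (eq_bigr (fun i => nrm (f i - b *: Ainv (f i)) ^+ 2)); last first.
  by move=> i _; rewrite fcons_lift.
rewrite prodrXl -exprMn ler_pXn2r // nnegrE ?nrm_ge0 // mulr_ge0 ?nrm_ge0 //.
by apply: prodr_ge0 => i _; exact: nrm_ge0.
Qed.

End KrylovDeterminant.

(** * Continuity, bounded operators and compact spheres *)

Section Continuity.
Context {R : realType} {H : hilbertType R}.
Implicit Types (x y z : H) (a : R[i]) (k : nat).

Lemma cvg_nrmP (T : Type) (F : set_system T) (FF : Filter F) (g : T -> H) x :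
  (forall e : R, 0 < e -> \forall t \near F, nrm (x - g t) < e) -> g @ F --> x.
Proof.
move=> xg; apply/cvgrPdist_lt => e e0.
have eE : e = (complex.Re e)%:C by rewrite RRe_real // gtr0_real.
have e0' : 0 < complex.Re e by rewrite -ltcR -eE.
apply: filterS (xg _ e0') => t.
by rewrite nrmE eE ltcR.
Qed.

Lemma near_nrm x (e : R) : 0 < e -> \forall y \near x, nrm (x - y) < e.
Proof.
move=> e0; have e0' : 0 < e%:C by rewrite ltcR.
have /cvgrPdist_lt/(_ _ e0') : id @ x --> x by exact: cvg_id.
by apply: filterS => y; rewrite nrmE ltcR.
Qed.

Lemma nrm_continuous : continuous (@nrm R H).
Proof.
move=> x; apply/cvgrPdist_lt => e e0.
apply: filterS (near_nrm x e0) => y; apply: le_lt_trans.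
have le1 := nrmD (x - y) y; rewrite subrK in le1.
have le2 := nrmD (y - x) x; rewrite subrK -opprB nrmN in le2.
by rewrite ler_norml; apply/andP; split; lra.
Qed.

Lemma nrm_cauchy_cvg (z : nat -> H) :
  (forall e : R, 0 < e -> exists N, forall n m, (N <= n)%N -> (N <= m)%N ->
    nrm (z n - z m) < e) ->
  exists l, forall e : R, 0 < e -> exists N, forall n, (N <= n)%N -> nrm (l - z n) < e.
Proof.
move=> z_cauchy.
have : cauchy (z n @[n --> \oo]).
  apply: cauchy_exP => e e0.
  have eE : e = (complex.Re e)%:C by rewrite RRe_real // gtr0_real.
  have e0' : 0 < complex.Re e by rewrite -ltcR -eE.
  have [N NP] := z_cauchy _ e0'; exists (z N); exists N => // n Nn.
  by rewrite /= -ball_normE /= nrmE eE ltcR NP.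
move=> /cauchy_cvg zc; exists (lim (z n @[n --> \oo])) => e e0.
have [N _ NP] := zc _ (near_nrm _ e0).
by exists N => n Nn; exact: NP.
Qed.

Lemma bounded_operatorP (T : {linear H -> H}) :
  bounded_operator T -> exists2 s : R, 0 < s & forall x, nrm (T x) <= s * nrm x.
Proof.
move=> /linear_boundedP [s0 [s0r Ts0]].
have s1 : s0 < `|s0| + 1.
  by rewrite (le_lt_trans (real_ler_norm s0r)) // ltrDl ltr01.
exists (complex.Re (`|s0| + 1)).
  by rewrite -ltcR RRe_real ?ltr_wpDl // realD ?normr_real ?real1.
move=> x; have := Ts0 _ s1 x; rewrite !nrmE.
have -> : `|s0| + 1 = (complex.Re (`|s0| + 1))%:C.
  by rewrite RRe_real // realD ?normr_real ?real1.
by rewrite -rmorphM lecR.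
Qed.

Lemma bounded_operator_continuous (T : {linear H -> H}) :
  bounded_operator T -> continuous T.
Proof. by move=> Tbd; apply: bounded_linear_continuous. Qed.

Lemma cvg_scale_real (T : Type) (F : set_system T) (FF : Filter F) (g : T -> R)
    (l : R) x : g @ F --> l -> (fun t => (g t)%:C *: x) @ F --> l%:C *: x.
Proof.
move=> gl; apply: cvg_nrmP => e e0.
have x1 : 0 < nrm x + 1 by rewrite ltr_wpDl ?nrm_ge0.
have /cvgrPdist_lt/(_ _ (divr_gt0 e0 x1)) := gl; apply: filterS => t.
rewrite ltr_pdivlMr // -scalerBl -rmorphB nrmZ cmod_real; apply: le_lt_trans.
by rewrite ler_wpM2l // lerDl.
Qed.

Lemma spanned_sphere_compact k (f : 'I_k -> H) : orthonormal_family f ->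
  compact [set x | spanned f x /\ nrm x = 1].
Proof.
move=> fo.
pose Q := [set v : 'rV[R]_k | forall i, [set` `[-1, 1]] (v ord0 i)].
have Qc : compact Q.
  apply: (@rV_compact R k (fun=> [set` `[-1, 1]])) => i.
  exact: segment_compact.
pose Phi (p : 'rV[R]_k * 'rV[R]_k) : H :=
  \sum_i ((p.1 ord0 i)%:C *: f i + (p.2 ord0 i)%:C *: ('i%C *: f i)).
have Phi_cont : continuous Phi.
  rewrite /Phi; apply: continuous_big => [|i _ p].
    exact: pseudometric_normed_Zmodule.add_continuous.
  apply: cvgD.
    apply: cvg_scale_real.
    apply: (cvg_comp _ (fun v : 'rV[R]_k => v ord0 i)); first exact: cvg_fst.
    exact: coord_continuous.
  apply: cvg_scale_real.
  apply: (cvg_comp _ (fun v : 'rV[R]_k => v ord0 i)); first exact: cvg_snd.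
  exact: coord_continuous.
have PhiE p : Phi p =
    lincomb (fun i => (p.1 ord0 i)%:C + 'i%C * (p.2 ord0 i)%:C) f.
  by apply: eq_bigr => i _; rewrite scalerA -scalerDl [_%:C * 'i%C]mulrC.
have PhiQ : compact (Phi @` (Q `*` Q)).
  apply: continuous_compact; last exact: compact_setX.
  exact: continuous_subspaceT.
have sphere_closed : closed [set x : H | nrm x = 1].
  have -> : [set x : H | nrm x = 1] = @nrm R H @^-1` [set 1] by [].
  by apply: closed_comp; [move=> x _; exact: nrm_continuous | exact: (@closed_eq R 1)].
have -> : [set x | spanned f x /\ nrm x = 1] =
    Phi @` (Q `*` Q) `&` [set x | nrm x = 1].
  apply/seteqP; split=> x /=.
    move=> [[c _ cx] x1]; split=> //.
    have c1 i : cmod (c i) <= 1.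
      rewrite -(dotp_lincomb_orthonormal c i fo) cx.
      by rewrite (le_trans (CauchySchwarz _ _)) // x1 nrm_orthonormal // mulr1.
    exists (\row_i complex.Re (c i), \row_i complex.Im (c i)).
      split=> i /=; rewrite mxE in_itv /= -ler_norml.
        exact: le_trans (Re_le_cmod _) (c1 i).
      rewrite -(ler_pXn2r (n := 2)) ?nnegrE // expr1n real_normK ?num_real //.
      have : cmod (c i) ^+ 2 <= 1 by rewrite expr_le1 ?cmod_ge0.
      by rewrite sqr_cmod; apply: le_trans; rewrite lerDr sqr_ge0.
    rewrite PhiE -cx; congr lincomb; apply/funext => i /=.
    by rewrite !mxE -complexE.
  move=> [[p _ <-] x1]; split=> //; rewrite PhiE.
  by exists (fun i => (p.1 ord0 i)%:C + 'i%C * (p.2 ord0 i)%:C).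
exact: compact_closedI.
Qed.

Lemma opnorm_bound (T : {linear H -> H}) : bounded_operator T ->
  forall x, nrm (T x) <= opnorm T * nrm x.
Proof.
move=> /bounded_operatorP[s s0 Ts] x.
apply: (@homogeneous_bound _ _ T setT) => // z _ z1.
apply: ub_le_sup; last by exists z; rewrite //= z1.
exists s => _ [y y1 <-]; apply: le_trans (Ts y) _.
by rewrite ger_pMr.
Qed.

Lemma opnorm_ge0 (T : H -> H) : 0 <= opnorm T.
Proof.
rewrite /opnorm; set U := [set nrm (T x) | x in _].
have [U_sup|/sup_out -> //] := pselect (has_sup U).
have [[s Us] ub] := U_sup; apply: le_trans (ub_le_sup ub Us).
by case: Us => x _ <-; exact: nrm_ge0.
Qed.

End Continuity.

(** * Descent on the numerical range *)

Section NumericalRange.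
Context {R : realType} {H : hilbertType R}.
Implicit Types (x y z : H) (a b c d p q : R[i]).

(** To first order in [s] the left side is at most the right one, with equality if
    [X = 2 rho]. The second-order terms [s^2 n] and [s^2 al] then decide, [ga] being
    of order four. *)
Lemma sqr_gap_small_step (X rho n al ga : R) : 0 < n -> al <= 0 -> 0 <= ga ->
  X <= 2 * rho -> exists2 s : R, 0 < s &
  (1 + s * X + s ^+ 2 * al) ^+ 2 + s ^+ 4 * ga <
  (1 + 2 * s * rho + s ^+ 2 * n) ^+ 2.
Proof.
move=> n0 al0 ga0 Xrho; pose D := 4 * `|X| + 4 * `|al| + ga / n + 4.
have gn0 : 0 <= ga / n by rewrite divr_ge0 // ltW.
have nX : 0 <= `|X| by []. have nal : 0 <= `|al| by [].
have D0 : 0 < D by rewrite /D; lra.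
have sD : D^-1 * D = 1 by rewrite mulVf // gt_eqF.
set s := D^-1 in sD *; have s0 : 0 < s by rewrite invr_gt0.
have s_le u : 0 <= u -> u <= D -> s * u <= 1.
  by move=> u0 uD; rewrite -sD ler_wpM2l // ltW.
have s1 : s * 4 <= 1 by apply: s_le => //; rewrite /D; lra.
have sX : s * (4 * `|X|) <= 1 by apply: s_le; rewrite /D; lra.
have sal : s * (4 * `|al|) <= 1 by apply: s_le; rewrite /D; lra.
have sga : s * (ga / n) <= 1 by apply: s_le; rewrite /D; lra.
exists s => //; set P := 1 + s * X; set Q := s ^+ 2.
have Q0 : 0 < Q by rewrite exprn_gt0.
have Xl : - `|X| <= X by rewrite lerNl -normrN ler_norm.
have sXl : s * - `|X| <= s * X by rewrite ler_wpM2l // ltW.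
have P34 : 3 / 4 <= P by rewrite /P; lra.
have all_ : - `|al| <= al by rewrite lerNl -normrN ler_norm.
have Qal : - (1 / 16) <= Q * al.
  have : s * (s * - `|al|) <= s * (s * al) by rewrite !ler_wpM2l // ltW.
  have : s * (s * `|al|) <= s * (1 / 4) by apply: ler_wpM2l; lra.
  by rewrite /Q expr2 -mulrA; lra.
have Qal0 : Q * al <= 0 by rewrite mulr_ge0_le0 // ltW.
have le1 : (P + Q * al) ^+ 2 <= P ^+ 2.
  by rewrite ler_pXn2r // ?nnegrE; lra.
have Qn0 : 0 < Q * n by rewrite mulr_gt0.
have srho : s * X <= 2 * s * rho.
  by rewrite mulrAC [2 * rho * s]mulrC ler_wpM2l // ltW.
have le2 : (P + Q * n) ^+ 2 <= (1 + 2 * s * rho + Q * n) ^+ 2.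
  by rewrite ler_pXn2r // ?nnegrE; rewrite /P in P34 *; lra.
have le3 : s ^+ 4 * ga <= Q * n / 4.
  have -> : s ^+ 4 * ga = Q * n * (s * (s * (ga / n))).
    by rewrite /Q; field; rewrite gt_eqF.
  rewrite ler_wpM2l ?(ltW Qn0) //.
  have : s * (s * (ga / n)) <= s * 1 by rewrite ler_wpM2l // ltW.
  by lra.
have le4 : 3 / 4 * (Q * n) <= P * (Q * n) by rewrite ler_wpM2r // ltW.
have sq0 : 0 <= (Q * n) ^+ 2 by rewrite sqr_ge0.
have : (P + Q * n) ^+ 2 = P ^+ 2 + 2 * (P * (Q * n)) + (Q * n) ^+ 2 by ring.
by lra.
Qed.

(** The imaginary part is a real linear form in the two coordinates of [d], so it
    vanishes on a line; the sign of [d] on that line is still free. *)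
Lemma real_cross_term p q (rho : R[i] -> R) : (forall d, rho (- d) = - rho d) ->
  exists2 d, d != 0 & complex.Im (Num.conj d * p + d * q) = 0 /\
                      complex.Re (Num.conj d * p + d * q) <= 2 * rho d.
Proof.
move=> rhoN.
have [d d0 Im0] : exists2 d, d != 0 & complex.Im (Num.conj d * p + d * q) = 0.
  case: p q => p1 p2 [q1 q2].
  have [pq|pq] := eqVneq (p2 + q2) 0.
    exists 1; first exact: oner_neq0.
    by rewrite rmorph1 !mul1r /=.
  exists ((p1 - q1) +i* (p2 + q2)).
    by rewrite eq_complex /= (negbTE pq) andbF.
  by rewrite conj_conjc /=; ring.
have [le|/ltW le] := lerP (complex.Re (Num.conj d * p + d * q)) (2 * rho d).
  by exists d.
exists (- d); first by rewrite oppr_eq0.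
rewrite rmorphN !mulNr -opprD ReN rhoN mulrN lerN2; split=> //.
by case: (_ + _) Im0 => u v /= ->; rewrite oppr0.
Qed.

(** The core of the Toeplitz-Hausdorff theorem. Along [z = z0 + s d z1] the quotient
    [h z / h z0] is [1 + s X + s^2 h1] with [Re h1 <= 0], where real_cross_term makes
    [X] real and at most [2 rho], while [|z|^2 = 1 + 2 s rho + s^2 |d|^2]. The second
    quantity is the larger one for small [s], by sqr_gap_small_step. *)
Lemma numerical_range_descent (E S : {linear H -> H}) z0 z1
    (h := fun z => dotp (E z) (S z)) :
  nrm z0 = 1 -> nrm z1 = 1 -> h z0 != 0 ->
  complex.Re (Num.conj (h z0) * h z1) <= 0 ->
  exists c, cmod (h (z0 + c *: z1)) < cmod (h z0) * nrm (z0 + c *: z1) ^+ 2.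
Proof.
move=> nz0 nz1 h00 Re_le0.
pose p := dotp (E z0) (S z1) / h z0; pose q := dotp (E z1) (S z0) / h z0.
pose rho d := rdot z0 (d *: z1).
have rhoN d : rho (- d) = - rho d by rewrite /rho scaleNr rdotNr.
have [d d0 [Im0 Re_le]] := real_cross_term p q rhoN.
pose h1 := (cmod d ^+ 2)%:C * (h z1 / h z0).
have d2 : 0 < cmod d ^+ 2 by rewrite exprn_gt0 // lt_def cmod_eq0 d0 cmod_ge0.
have h0m : 0 < cmod (h z0) by rewrite lt_def cmod_eq0 h00 cmod_ge0.
have Re_h1 : complex.Re h1 <= 0.
  rewrite /h1 ReMr; apply: mulr_ge0_le0; first exact: ltW.
  have -> : h z1 / h z0 = ((cmod (h z0) ^+ 2)^-1)%:C * (Num.conj (h z0) * h z1).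
    have -> : ((cmod (h z0) ^+ 2)^-1)%:C = (h z0 * Num.conj (h z0))^-1.
      by rewrite mul_conj_cmod -fmorphV.
    by field; rewrite conjC_eq0 h00.
  by rewrite ReMr mulr_ge0_le0 // invr_ge0 sqr_ge0.
have [s s0 lt] := sqr_gap_small_step d2 Re_h1 (sqr_ge0 (complex.Im h1)) Re_le.
exists (s%:C * d); set z := z0 + _.
have hE : h z = h z0 * (1 + s%:C * (Num.conj d * p + d * q) + (s ^+ 2)%:C * h1).
  have zL (T : {linear H -> H}) : T z = T z0 + (s%:C * d) *: T z1.
    by rewrite /z linearD linearZ.
  rewrite {1}/h !zL dotpDl !dotpDr !dotpZl !dotpZr -/(h z0) -/(h z1).
  rewrite rmorphM /= conj_realc /h1 -mul_conj_cmod rmorphXn /= /p /q.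
  by move: (dotp _ _) (dotp _ _) (h z1) => u v w; field.
have nE : nrm z ^+ 2 = 1 + 2 * s * rho d + s ^+ 2 * cmod d ^+ 2.
  rewrite /z -scalerA sqr_nrmD nz0 expr1n rdotZr nrmZ cmod_real nrmZ nz1 mulr1.
  by rewrite exprMn real_normK ?num_real // mulrA.
rewrite hE cmodM ltr_pM2l //.
rewrite -(ltr_pXn2r (n := 2)) ?nnegrE ?cmod_ge0 ?sqr_ge0 // nE.
apply: le_lt_trans lt; rewrite sqr_cmod.
move: Im0; set w := _ + d * q; case: w => w1 w2 /= ->.
move: h1 {hE Re_h1} => [u1 u2] /=; rewrite !mul0r !mulr0 !subr0 !addr0 !add0r.
by rewrite le_eqVlt; apply/orP; left; apply/eqP; ring.
Qed.

End NumericalRange.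

(** * A scalar that serves a whole subspace *)

Section UniformScalar.
Context {R : realType} {H : hilbertType R}.
Implicit Types (x y z w : H) (a b c : R[i]).

Lemma coercive_Lipschitz_min (g : R[i] -> R) (s0 s1 : R) : 0 < s0 -> 0 <= s1 ->
  (forall a b, g a <= g b + s1 * cmod (b - a)) ->
  (forall b, s0 * cmod b - g 0 <= g b) -> exists b0, forall b, g b0 <= g b.
Proof.
move=> s00 s10 gL g_coer.
pose L := 2 * `|g 0| / s0.
have L0 : 0 <= L by rewrite divr_ge0 ?mulr_ge0 // ltW.
pose I : set R := [set` `[- L, L]].
have Ic : compact (I `*` I) by apply: compact_setX; exact: segment_compact.
pose G (p : R * R) := g (p.1 +i* p.2).
have GC : continuous G.
  move=> p; apply/cvgrPdist_lt => e e0.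
  have d0 : 0 < e / (2 * (s1 + 1)) by rewrite divr_gt0 // mulr_gt0 // ltr_wpDl.
  have near1 : \forall t \near p, `|p.1 - t.1| < e / (2 * (s1 + 1)).
    have /cvgrPdist_lt/(_ _ d0) : fst @ p --> p.1 by exact: cvg_fst.
    by [].
  have near2 : \forall t \near p, `|p.2 - t.2| < e / (2 * (s1 + 1)).
    have /cvgrPdist_lt/(_ _ d0) : snd @ p --> p.2 by exact: cvg_snd.
    by [].
  apply: filterS2 near1 near2 => t; set d := e / _.
  move=> lt1 lt2.
  have eE : e = 2 * d * (s1 + 1).
    by rewrite /d; field; rewrite gt_eqF // ltr_wpDl.
  have cle (u v : R) : cmod (u +i* v) <= `|u| + `|v|.
    rewrite -(ler_pXn2r (n := 2)) ?nnegrE ?cmod_ge0 ?addr_ge0 // sqr_cmod /=.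
    rewrite sqrrD !real_normK ?num_real //.
    by rewrite lerD2r lerDl mulrn_wge0 ?mulr_ge0.
  have le1 := gL (p.1 +i* p.2) (t.1 +i* t.2).
  have le2 := gL (t.1 +i* t.2) (p.1 +i* p.2).
  have le3 := cle (p.1 - t.1) (p.2 - t.2).
  rewrite (_ : (t.1 +i* t.2) - (p.1 +i* p.2) =
    - ((p.1 - t.1) +i* (p.2 - t.2))) ?cmodN in le1; last first.
    by apply/eqP; rewrite eq_complex /= !opprB !eqxx.
  rewrite (_ : (p.1 +i* p.2) - (t.1 +i* t.2) =
    ((p.1 - t.1) +i* (p.2 - t.2))) in le2; last by [].
  have lt3 : cmod ((p.1 - t.1) +i* (p.2 - t.2)) <= 2 * d by lra.
  have lt4 : s1 * cmod ((p.1 - t.1) +i* (p.2 - t.2)) <= s1 * (2 * d).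
    by rewrite ler_wpM2l.
  rewrite /G ltr_norml eE; have d_gt0 : 0 < d by [].
  by apply/andP; split; lra.
have [|p0 p0I p0_min] := compact_EVT_min _ Ic (continuous_subspaceT GC).
  by exists (0, 0); split; rewrite /I /= in_itv /= oppr_le0 L0.
exists (p0.1 +i* p0.2) => b.
have [bL|bL] := leP (cmod b) L.
  have in_L u : `|u| <= cmod b -> u \in `[- L, L].
    by move=> ub; rewrite in_itv /= -ler_norml (le_trans ub).
  have -> : b = complex.Re b +i* complex.Im b by case: (b).
  apply: (p0_min (complex.Re b, complex.Im b)).
  rewrite inE; split; apply: in_L; first exact: Re_le_cmod.
  rewrite -(ler_pXn2r (n := 2)) ?nnegrE ?cmod_ge0 // real_normK ?num_real //.
  by rewrite sqr_cmod lerDr sqr_ge0.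
have : G p0 <= g 0.
  apply: (p0_min (0, 0)); rewrite inE.
  by split; rewrite /I /= in_itv /= oppr_le0 L0.
rewrite /G => /le_trans; apply; apply: le_trans (g_coer b).
have : 2 * `|g 0| <= s0 * cmod b by rewrite -ler_pdivrMl // mulrC ltW.
by have := ler_norm (g 0); lra.
Qed.

(** The defect [m^2 |x|^2 - |E x|^2] obeys the parallelogram law and is
    nonnegative; vanishing at [x] and [y], it vanishes at [x + y] and [x - y]. *)
Lemma maximal_vectorsD (E : {linear H -> H}) (V : set H) (m : R) x y :
  (forall u v, V u -> V v -> V (u + v)) -> (forall v, V v -> V (- v)) ->
  (forall v, V v -> nrm (E v) <= m * nrm v) ->
  V x -> V y -> 0 <= m -> nrm (E x) = m * nrm x -> nrm (E y) = m * nrm y ->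
  nrm (E (x + y)) = m * nrm (x + y).
Proof.
move=> VD VN Em Vx Vy m0 Ex Ey.
have sq v : V v -> nrm (E v) ^+ 2 <= (m * nrm v) ^+ 2.
  by move=> Vv; rewrite ler_pXn2r ?nnegrE ?mulr_ge0 ?nrm_ge0 ?Em.
have Vp := VD _ _ Vx Vy; have Vm := VD _ _ Vx (VN _ Vy).
apply/eqP; rewrite -(eqrXn2 (n := 2)) ?mulr_ge0 ?nrm_ge0 //.
rewrite eq_le sq //=; have := sq _ Vm.
rewrite linearB linearD /= !exprMn !sqr_nrmB !sqr_nrmD Ex Ey !exprMn.
by move: (rdot _ _) (rdot _ _) => u v; lra.
Qed.

Lemma rdot_continuous (E S : {linear H -> H}) :
  continuous E -> continuous S -> continuous (fun x => rdot (E x) (S x)).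
Proof.
move=> Ec Sc.
have -> : (fun x => rdot (E x) (S x)) =
    (fun x => 4^-1 * (nrm (E x + S x) ^+ 2 - nrm (E x - S x) ^+ 2)).
  by apply/funext => x; rewrite sqr_nrmD sqr_nrmB; field.
move=> x; apply: cvgM; first exact: cvg_cst.
have nc (T : H -> H) : T @ x --> T x -> (fun y => nrm (T y) ^+ 2) @ x --> nrm (T x) ^+ 2.
  move=> Tc; have nT : nrm (T y) @[y --> x] --> nrm (T x).
    by apply: (cvg_comp T (@nrm R H) Tc); exact: nrm_continuous.
  exact: (cvgM nT nT).
apply: cvgB; apply: nc; first exact: (cvgD (Ec x) (Sc x)).
exact: (cvgB (Ec x) (Sc x)).
Qed.

Lemma sqr_nrm_continuous (E : {linear H -> H}) :
  continuous E -> continuous (fun x => nrm (E x) ^+ 2).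
Proof.
move=> Ec; have -> : (fun x => nrm (E x) ^+ 2) = (fun x => rdot (E x) (E x)).
  by apply/funext => x; rewrite rdotpp.
exact: rdot_continuous.
Qed.

End UniformScalar.

Section AsplundPtak.
Context {R : realType} {H : hilbertType R}.
Implicit Types (x y z w : H) (a b c : R[i]).

Definition pencil (S : {linear H -> H}) b : {linear H -> H} := idfun \- (b \*: S).

Lemma pencilE S b x : pencil S b x = x - b *: S x.
Proof. by []. Qed.

Lemma scale_continuous (S : {linear H -> H}) b : continuous S -> continuous (b \*: S).
Proof. by move=> Sc x; exact: cvgZl_tmp (Sc x). Qed.

Lemma pencil_continuous (S : {linear H -> H}) b : continuous S -> continuous (pencil S b).
Proof. by move=> Sc x; apply: cvgB; [exact: cvg_id | exact: scale_continuous]. Qed.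

(** The Asplund-Ptak theorem: a scalar minimizing the norm of [1 - b S] on the span
    of [f] does as well as scalars chosen vector by vector. Let [b0] be a minimizer,
    [E = 1 - b0 S], and [m] the norm of [E]. Among the unit vectors with [|E z| = m]
    choose one where [|<E z, S z>|] is smallest. If that value is 0, then
    [|z - b S z| >= m] for every [b], so [m <= M]. If not, optimality of [b0] supplies a
    second such vector whose value makes an obtuse angle with it, and
    numerical_range_descent contradicts the choice of [z]. *)
Lemma uniform_scalar k (f : 'I_k -> H) (S : {linear H -> H}) (s0 M : R) :
  orthonormal_family f -> 0 <= M -> 0 < s0 ->
  (forall x, s0 * nrm x <= nrm (S x)) -> bounded_operator S ->
  (forall w, exists b, nrm (w - b *: S w) <= M * nrm w) ->
  exists b, forall w, spanned f w -> nrm (w - b *: S w) <= M * nrm w.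
Proof.
move=> fo M0 s00 S_low S_bd pointwise.
have [s1 s1_gt0 S_up] := bounded_operatorP S_bd.
have Sc := bounded_operator_continuous S_bd.
pose K := [set x | spanned f x /\ nrm x = 1].
have Kc : compact K := spanned_sphere_compact fo.
have onK (E : {linear H -> H}) (m : R) : (forall z, K z -> nrm (E z) <= m) ->
    forall w, spanned f w -> nrm (E w) <= m * nrm w.
  move=> Em; apply: homogeneous_bound => [a w|w fw nw]; first exact: spannedZ.
  exact: Em.
have [[x1 Kx1]|K0] := pselect (K !=set0); last first.
  exists 0 => w fw; rewrite -pencilE; apply: onK => // z Kz.
  by case: K0; exists z.
have maxK b : exists z, K z /\ forall x, K x -> nrm (pencil S b x) <= nrm (pencil S b z).
  have nE_cont : continuous (fun x => nrm (pencil S b x)).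
    move=> x; apply: (cvg_comp (pencil S b) (@nrm R H)).
      exact: pencil_continuous.
    exact: nrm_continuous.
  have [|z zK z_max] := compact_EVT_max _ Kc (continuous_subspaceT nE_cont).
    by exists x1.
  rewrite inE in zK; exists z; split=> // x Kx; apply: z_max; exact/mem_set.
have [zf zfP] := choice maxK.
pose g b := nrm (pencil S b (zf b)).
have g_ge b x : K x -> nrm (pencil S b x) <= g b := (zfP b).2 x.
have Kzf b : K (zf b) := (zfP b).1.
have nS x : K x -> nrm (S x) <= s1.
  by move=> [_ x1']; rewrite (le_trans (S_up x)) // x1' mulr1.
have gL a b : g a <= g b + s1 * cmod (b - a).
  rewrite /g; have -> : pencil S a (zf a) = pencil S b (zf a) + (b - a) *: S (zf a).
    by rewrite !pencilE scalerBl addrA subrK.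
  apply: le_trans (nrmD _ _) _; rewrite lerD ?g_ge // nrmZ mulrC.
  by rewrite ler_wpM2r ?cmod_ge0 ?nS.
have g0 : g 0 = 1 by rewrite /g pencilE scale0r subr0; case: (Kzf 0).
have g_coer b : s0 * cmod b - g 0 <= g b.
  rewrite g0; apply: le_trans (g_ge b x1 Kx1); rewrite pencilE lerBlDr.
  have := S_low x1; rewrite Kx1.2 mulr1 => low.
  have le1 : s0 * cmod b <= nrm (b *: S x1).
    by rewrite nrmZ mulrC ler_wpM2l ?cmod_ge0.
  apply: le_trans le1 _; rewrite -[X in _ <= _ + X]Kx1.2.
  rewrite -[X in nrm X <= _](subKr x1) [X in _ <= X]addrC.
  exact: nrmB.
have [b0 b0_min] := coercive_Lipschitz_min s00 (ltW s1_gt0) gL g_coer.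
have [gM|Mg] := leP (g b0) M.
  exists b0 => w fw; rewrite -pencilE; apply: le_trans (onK _ (g b0) _ _ fw) _.
    by move=> z /g_ge.
  by rewrite ler_wpM2r ?nrm_ge0.
exfalso; pose E := pencil S b0; have [m mE] : exists m, m = g b0 by exists (g b0).
rewrite -mE in Mg; have m_min b : m <= g b by rewrite mE.
have E_le x : K x -> nrm (E x) <= m by rewrite mE; exact: g_ge.
have m0 : 0 < m := le_lt_trans M0 Mg.
have m_ge0 : 0 <= m := ltW m0.
have Em x : spanned f x -> nrm (E x) <= m * nrm x.
  by apply: onK => z Kz; exact: E_le.
pose h x := dotp (E x) (S x).
have Ec : continuous E by exact: pencil_continuous.
(* Were Re(conj d <E z, S z>) positive at every maximal z, then a small move of
   b0 towards d would lower the maximum of |E z|; max(m^2 - |E z|^2, .) having a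
   positive minimum on the sphere makes this uniform. *)
have optimal d : exists z, K z /\ nrm (E z) = m /\ complex.Re (Num.conj d * h z) <= 0.
  pose phi x := Num.max (m ^+ 2 - nrm (E x) ^+ 2) (rdot (E x) ((d \*: S) x)).
  have phi_cont : continuous phi.
    have c1 : continuous (fun x => m ^+ 2 - nrm (E x) ^+ 2).
      by move=> x; apply: cvgB; [exact: cvg_cst | exact: sqr_nrm_continuous].
    have c2 : continuous (fun x => rdot (E x) ((d \*: S) x)).
      by apply: rdot_continuous => //; exact: scale_continuous.
    rewrite /phi; under [X in continuous X]eq_fun do rewrite maxr_absE.
    move=> x; apply: cvgM; last exact: cvg_cst.
    apply: cvgD; first exact: (cvgD (c1 x) (c2 x)).
    exact: cvg_norm (cvgB (c1 x) (c2 x)).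
  have [|z zK z_min] := compact_EVT_min _ Kc (continuous_subspaceT phi_cont).
    by exists x1.
  rewrite inE in zK.
  have [phi0|phi0] := leP (phi z) 0.
    exists z; split=> //; move: phi0; rewrite ge_max => /andP[le1 le2].
    split; last by move: le2; rewrite /rdot dotpZr.
    apply/eqP; rewrite eq_le E_le //=.
    by rewrite -(ler_pXn2r (n := 2)) ?nnegrE ?nrm_ge0 // -subr_le0.
  set e := phi z in phi0.
  have phi_ge x : K x -> e <= phi x by move=> Kx; apply: z_min; exact/mem_set.
  pose D := cmod d * s1; have D0 : 0 <= D by rewrite mulr_ge0 ?cmod_ge0 ?ltW.
  pose N := 2 * m * D + D ^+ 2 + 1 + e.
  have mD : 0 <= m * D by rewrite mulr_ge0 // ltW.
  have DD : 0 <= D ^+ 2 by rewrite sqr_ge0.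
  have N0 : 0 < N by rewrite /N; lra.
  pose t := e / N; have t0 : 0 < t by rewrite divr_gt0.
  have t_ge0 : 0 <= t := ltW t0.
  have tN : t * N = e by rewrite divfK // gt_eqF.
  have t1 : t <= 1 by rewrite ler_pdivrMr // mul1r /N; lra.
  pose x := zf (b0 + t%:C * d); have Kx : K x by exact: Kzf.
  have : m <= nrm (E x - t%:C *: (d *: S x)).
    have := m_min (b0 + t%:C * d); rewrite /g -/x pencilE scalerDl scalerA.
    by rewrite opprD addrA.
  rewrite -(ler_pXn2r (n := 2)) ?nnegrE ?nrm_ge0 // sqr_nrmB.
  rewrite rdotZr nrmZ cmod_real exprMn real_normK ?num_real //.
  have dS : nrm (d *: S x) <= D by rewrite nrmZ ler_wpM2l ?cmod_ge0 ?nS.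
  have dS2 : t ^+ 2 * nrm (d *: S x) ^+ 2 <= t ^+ 2 * D ^+ 2.
    by rewrite ler_wpM2l ?sqr_ge0 // ler_pXn2r ?nnegrE ?nrm_ge0.
  have tt : t ^+ 2 * D ^+ 2 <= t * D ^+ 2.
    by rewrite ler_wpM2r // expr2 ger_pMr.
  have Ex : nrm (E x) <= m by exact: E_le.
  have Ex2 : nrm (E x) ^+ 2 <= m ^+ 2.
    by rewrite ler_pXn2r ?nnegrE ?nrm_ge0.
  have tmD : 0 <= t * (m * D) by rewrite mulr_ge0 // ltW.
  have tDD : 0 <= t * D ^+ 2 by rewrite mulr_ge0 // ltW.
  have te : 0 < t * e by rewrite mulr_gt0.
  have tNE : t * (2 * m * D + D ^+ 2 + 1 + e) = e by exact: tN.
  have := phi_ge x Kx; rewrite le_max => /orP[le1|le1] le2.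
    have : - rdot (E x) (d *: S x) <= m * D.
      rewrite lerNl; apply: le_trans (_ : - `|rdot (E x) (d *: S x)| <= _).
        rewrite lerN2; apply: le_trans (rdot_le _ _) _.
        by apply: ler_pM; rewrite ?nrm_ge0.
      by rewrite lerNl ler_normr lexx orbT.
    move=> /(ler_wpM2l t_ge0) le3.
    by lra.
  have le3 : t * e <= t * rdot (E x) (d *: S x) by rewrite ler_wpM2l.
  have le4 : t ^+ 2 * D ^+ 2 <= t * (t * (D ^+ 2 + 0)).
    by rewrite expr2 addr0 mulrA.
  have le5 : t * (t * (D ^+ 2 + 0)) <= t * e.
    by rewrite ler_wpM2l // addr0; lra.
  by lra.
have [z' [Kz' [Ez' _]]] := optimal 0.
pose Km := K `&` [set x | nrm (E x) ^+ 2 = m ^+ 2].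
have KmE x : Km x -> K x /\ nrm (E x) = m.
  by move=> [Kx /eqP]; rewrite eqrXn2 ?nrm_ge0 // => /eqP Ex.
have Kmc : compact Km.
  apply: compact_closedI => //.
  have -> : [set x | nrm (E x) ^+ 2 = m ^+ 2] =
    (fun x => nrm (E x) ^+ 2) @^-1` [set m ^+ 2] by [].
  apply: closed_comp; last exact: (@closed_eq R (m ^+ 2)).
  by move=> x _; exact: sqr_nrm_continuous.
have h_cont : continuous (fun x => cmod (h x) ^+ 2).
  have -> : (fun x => cmod (h x) ^+ 2) = (fun x =>
      rdot (E x) (S x) * rdot (E x) (S x) +
      rdot (E x) (('i%C \*: S) x) * rdot (E x) (('i%C \*: S) x)).
    apply/funext => x; rewrite sqr_cmod /rdot dotpZr -/(h x) conj_conjc.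
    by case: (h x) => u v /=; ring.
  have iS_cont : continuous ('i%C \*: S) by exact: scale_continuous.
  move=> x; apply: cvgD; apply: cvgM; exact: rdot_continuous.
have [|z0 z0K z0_min] := compact_EVT_min _ Kmc (continuous_subspaceT h_cont).
  by exists z'; split=> //=; rewrite Ez'.
rewrite inE in z0K; have [Kz0 Ez0] := KmE _ z0K.
have [h0|h0] := eqVneq (h z0) 0.
  have [b] := pointwise z0; rewrite Kz0.2 mulr1.
  have -> : z0 - b *: S z0 = E z0 + (b0 - b) *: S z0.
    by rewrite /E pencilE scalerBl addrA subrK.
  rewrite leNgt => /negP; apply.
  rewrite -(ltr_pXn2r (n := 2)) ?nnegrE ?nrm_ge0 // sqr_nrm_pythag.
    apply: lt_le_trans (_ : nrm (E z0) ^+ 2 <= _); last by rewrite lerDl sqr_ge0.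
    by rewrite Ez0 ltr_pXn2r ?nnegrE.
  by rewrite dotpZr -/(h z0) h0 mulr0.
have [z1 [Kz1 [Ez1 Re_le0]]] := optimal (h z0).
have [c] := numerical_range_descent Kz0.2 Kz1.2 h0 Re_le0.
set y := z0 + c *: z1; rewrite -/(h y) -/(h z0) ltNge => /negP; apply.
have fy : spanned f y by apply: spannedD Kz0.1 (spannedZ _ Kz1.1).
have Ey : nrm (E y) = m * nrm y.
  apply: (maximal_vectorsD (V := spanned f)) => //; last 1 first.
  - by rewrite linearZ /= nrmZ nrmZ Ez1 Kz1.2 mulr1 mulrC.
  - exact: spannedD.
  - by move=> v fv; rewrite -scaleN1r; exact: spannedZ.
  - exact: Kz0.1.
  - exact/spannedZ/Kz1.1.
  - by rewrite Ez0 Kz0.2 mulr1.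
have [->|y0] := eqVneq y 0; first by rewrite nrm0 expr0n mulr0 cmod_ge0.
have ny : 0 < nrm y by rewrite nrm_gt0.
pose u := (nrm y)^-1%:C *: y.
have nEu : nrm (E u) = m.
  by rewrite [E u]linearZ_LR nrmZ cmod_inv_nrm Ey mulrCA mulVf ?mulr1 // gt_eqF.
have Kmu : Km u.
  split; first split; first exact: spannedZ.
    exact: nrm_normalize.
  exact: (congr1 (fun v => v ^+ 2) nEu).
have hu : h u = ((nrm y)^-1 ^+ 2)%:C * h y.
  rewrite /h [E u]linearZ_LR [S u]linearZ_LR dotpZl dotpZr conj_realc mulrA.
  by rewrite -rmorphM.
have := z0_min u (mem_set Kmu).
rewrite ler_pXn2r ?nnegrE ?cmod_ge0 // hu cmodM cmod_real ger0_norm ?sqr_ge0 //.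
by rewrite exprVn mulrC ler_pdivlMr // exprn_gt0.
Qed.

End AsplundPtak.

(** * Compact operators and their singular values *)

Section CompactOperators.
Context {R : realType} {H : hilbertType R}.
Variable C : {linear H -> H}.
Hypothesis Ccpt : compact_operator C.
Implicit Types (x y z e : H) (a b c : R[i]) (k j n : nat) (es : seq H).

Lemma compact_operator_bounded :
  exists2 s : R, 0 < s & forall x, nrm (C x) <= s * nrm x.
Proof.
have [U CU [Uc _]] := Ccpt.
have C0U : U 0 by apply: CU; exists 0; rewrite ?linear0 //= nrm0.
have [|u uU u_max] := compact_EVT_max _ Uc (continuous_subspaceT nrm_continuous).
  by exists 0.
have u0 : 0 <= nrm u := nrm_ge0 u.
exists (nrm u + 1) => [|x]; first by rewrite ltr_wpDl.
apply: (@homogeneous_bound _ _ C setT) => // y _ y1.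
apply: (@le_trans _ _ (nrm u)); last by rewrite lerDl.
by apply/u_max/mem_set/CU; exists y; rewrite //= y1.
Qed.

Lemma compact_operator_cluster (x : nat -> H) : (forall n, nrm (x n) <= 1) ->
  exists y, forall (e : R) N, 0 < e -> exists2 n, (N <= n)%N & nrm (C (x n) - y) < e.
Proof.
move=> x1; have [U CU [Uc _]] := Ccpt.
have [|y [_ y_cl]] := Uc (C (x n) @[n --> \oo]) _.
  by exists 0%N => // n _; apply: CU; exists (x n) => //=; exact: x1.
exists y => e N e0.
have FN : (C (x n) @[n --> \oo]) [set C (x n) | n in [set n | (N <= n)%N]].
  by exists N => // n Nn; exists n.
have [_ [[n Nn <-] lt]] := y_cl _ _ FN (near_nrm y e0).
by exists n => //; rewrite -nrmN opprB.
Qed.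

(** A maximizing sequence is Cauchy along a subsequence on which its image under
    [C] is: the defect [s^2 |x|^2 - |C x|^2] is nonnegative and obeys the
    parallelogram law, so it is small on differences of near-maximizers. *)
Lemma compact_operator_maximizer es : (exists2 x, orthogonal_to es x & x != 0) ->
  exists e, [/\ orthogonal_to es e, nrm e = 1 &
    forall x, orthogonal_to es x -> nrm (C x) <= nrm (C e) * nrm x].
Proof.
move=> [x0 ox0 x00]; have [b b0 Cb] := compact_operator_bounded.
pose A := [set nrm (C x) | x in [set x | orthogonal_to es x /\ nrm x = 1]].
pose x1 := (nrm x0)^-1%:C *: x0.
have x1V : orthogonal_to es x1 /\ nrm x1 = 1.
  by split; [exact: orthogonal_toZ | exact: nrm_normalize].
have A_sup : has_sup A.
  split; first by exists (nrm (C x1)), x1.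
  by exists b => _ [x [_ nx] <-]; rewrite (le_trans (Cb x)) // nx mulr1.
pose s := sup A.
have s_ub x : orthogonal_to es x -> nrm (C x) <= s * nrm x.
  apply: homogeneous_bound x => [a x|x ox nx]; first exact: orthogonal_toZ.
  by apply: (ub_le_sup A_sup.2); exists x.
have s_ge0 : 0 <= s.
  have := s_ub _ x1V.1; rewrite x1V.2 mulr1; exact: le_trans (nrm_ge0 _).
have [s0|s0] := eqVneq s 0.
  exists x1; split; [exact: x1V.1|exact: x1V.2|] => x ox.
  by rewrite (le_trans (s_ub _ ox)) // s0 mul0r mulr_ge0 ?nrm_ge0.
have s_gt0 : 0 < s by rewrite lt_def s0.
have eps n : 0 < n.+1%:R^-1 :> R by rewrite invr_gt0 ltr0n.
have /choice[x xP] : forall n, exists x,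
    [/\ orthogonal_to es x, nrm x = 1 & s - n.+1%:R^-1 < nrm (C x)].
  by move=> n; have [_ [x [ox nx] <-] lt] := sup_adherent (eps n) A_sup; exists x.
have [|y y_cl] := compact_operator_cluster (x := x).
  by move=> n; have [_ -> _] := xP n.
have /choice[f fP] : forall n, exists m, (n <= m)%N /\ nrm (C (x m) - y) < n.+1%:R^-1.
  by move=> n; have [m nm lt] := y_cl _ n (eps n); exists m.
pose z n := x (f n).
have oz n : orthogonal_to es (z n) by case: (xP (f n)).
have nz n : nrm (z n) = 1 by case: (xP (f n)).
have Cz n : s - n.+1%:R^-1 < nrm (C (z n)).
  have [_ _] := xP (f n); apply: le_lt_trans; rewrite lerB //.
  by rewrite lef_pV2 ?posrE ?ltr0n // ler_nat ltnS (fP n).1.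
have Cz_le n : nrm (C (z n)) <= s by have := s_ub _ (oz n); rewrite nz mulr1.
pose Q v := s ^+ 2 * nrm v ^+ 2 - nrm (C v) ^+ 2.
have Q_ge0 v : orthogonal_to es v -> 0 <= Q v.
  move=> ov; rewrite subr_ge0 -exprMn.
  by rewrite ler_pXn2r ?nnegrE ?mulr_ge0 ?nrm_ge0 ?s_ub.
have QD u v : Q (u + v) + Q (u - v) = 2 * Q u + 2 * Q v.
  rewrite /Q linearB linearD !sqr_nrmB !sqr_nrmD.
  by move: (rdot _ _) (rdot _ _) => ? ?; ring.
have Qz n : Q (z n) <= 2 * s * n.+1%:R^-1.
  rewrite /Q nz expr1n mulr1 subr_sqr [2 * s * _]mulrC.
  apply: ler_pM; rewrite ?subr_ge0 ?addr_ge0 ?nrm_ge0 //.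
    by rewrite lerBlDl -lerBlDr ltW.
  by rewrite mulr2n mulrDl mul1r lerD2l.
have Cdiff n m : nrm (C (z n - z m)) <= n.+1%:R^-1 + m.+1%:R^-1.
  have -> : C (z n - z m) = (C (z n) - y) - (C (z m) - y).
    by rewrite linearB opprB addrA subrK.
  by apply: le_trans (nrmB _ _) _; rewrite lerD // ltW // (fP _).2.
have zdiff n m (d : R) : n.+1%:R^-1 <= d -> m.+1%:R^-1 <= d ->
    s ^+ 2 * nrm (z n - z m) ^+ 2 <= 4 * d ^+ 2 + 8 * s * d.
  move=> nd md; have d0 : 0 <= d := le_trans (ltW (eps n)) nd.
  have := QD (z n) (z m); have := Q_ge0 _ (orthogonal_toD (oz n) (oz m)).
  have Qd i : i.+1%:R^-1 <= d -> Q (z i) <= 2 * s * d.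
    by move=> id; apply: le_trans (Qz i) _; rewrite ler_wpM2l // mulr_ge0.
  have := Qd _ nd; have := Qd _ md.
  have : nrm (C (z n - z m)) ^+ 2 <= (d + d) ^+ 2.
    rewrite ler_pXn2r ?nnegrE ?nrm_ge0 ?addr_ge0 //.
    by apply: le_trans (Cdiff n m) _; rewrite lerD.
  have -> : s ^+ 2 * nrm (z n - z m) ^+ 2 = Q (z n - z m) + nrm (C (z n - z m)) ^+ 2.
    by rewrite /Q subrK.
  move: (Q _) (Q _) (Q _) (Q _) (nrm _ ^+ 2) => q1 q2 q3 q4 q5.
  by lra.
have small (e : R) : 0 < e -> exists N, forall n, (N <= n)%N -> n.+1%:R^-1 < e :> R.
  move=> e0; exists (Num.trunc e^-1) => n Nn.
  rewrite invf_plt ?posrE // (lt_le_trans (truncnS_gt _)) // ler_nat ltnS //.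
have [l z_l] : exists l, forall e : R, 0 < e ->
    exists N, forall n, (N <= n)%N -> nrm (l - z n) < e.
  apply: nrm_cauchy_cvg => e e0.
  pose d := Num.min 1 (s * e ^+ 2 * s / (2 * (4 + 8 * s))).
  have se0 : 0 < s * e ^+ 2 * s by rewrite !mulr_gt0 // exprn_gt0.
  have s8 : 0 < 4 + 8 * s by lra.
  have d0 : 0 < d by rewrite lt_min ltr01 divr_gt0 // mulr_gt0.
  have [N NP] := small _ d0; exists N => n m Nn Nm.
  have := zdiff _ _ _ (ltW (NP _ Nn)) (ltW (NP _ Nm)) => le1.
  have d1 : d <= 1 by rewrite ge_min lexx.
  have d2 : d * (4 + 8 * s) <= s * e ^+ 2 * s / 2.
    have -> : s * e ^+ 2 * s / 2 = s * e ^+ 2 * s / (2 * (4 + 8 * s)) * (4 + 8 * s).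
      by field; rewrite gt_eqF.
    by rewrite ler_wpM2r ?(ltW s8) // /d ge_min lexx orbT.
  have dd : d ^+ 2 <= d by rewrite expr2 ger_pMr.
  rewrite -(ltr_pXn2r (n := 2)) ?nnegrE ?nrm_ge0 ?(ltW e0) //.
  rewrite -(ltr_pM2l (exprn_gt0 2 s_gt0)).
  have : s ^+ 2 * e ^+ 2 = s * e ^+ 2 * s by ring.
  by lra.
have dl (e : R) : 0 < e -> exists n, n.+1%:R^-1 < e /\ nrm (l - z n) < e.
  move=> e0; have [N NP] := z_l _ e0; have [N' NP'] := small _ e0.
  exists (maxn N N'); split; first by rewrite NP' ?leq_maxr.
  by rewrite NP ?leq_maxl.
have nl : nrm l = 1.
  apply/eqP; rewrite -subr_eq0 -normr_eq0 eq_le normr_ge0 andbT.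
  apply/ler_addgt0Pl => e e0; rewrite addr0.
  have [n [_ lt]] := dl _ e0; apply: le_trans (ltW lt).
  have := nrmD (l - z n) (z n); rewrite subrK nz.
  have := nrmB l (l - z n); rewrite subKr nz.
  by rewrite ler_norml => ? ?; apply/andP; split; lra.
have Cl : s <= nrm (C l).
  apply/ler_addgt0Pl => e e0.
  pose d := e / (1 + b).
  have d0 : 0 < d by rewrite divr_gt0 // addr_gt0.
  have eE : e = d + b * d by rewrite /d; field; rewrite gt_eqF // addr_gt0.
  have [n [lt1 lt2]] := dl _ d0.
  have le1 : s - d <= nrm (C (z n)).
    by apply: le_trans (ltW (Cz n)); rewrite lerB // ltW.
  have le2 : nrm (C (l - z n)) <= b * d.
    by apply: le_trans (Cb _) _; rewrite ler_wpM2l // ltW.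
  have := nrmB (C l) (C (l - z n)); rewrite -linearB subKr.
  by rewrite eE; lra.
exists l; split=> // [v v_in|v ov]; last first.
  by apply: le_trans (s_ub v ov) _; rewrite ler_wpM2r ?nrm_ge0.
apply/eqP; rewrite -cmod_eq0 eq_le cmod_ge0 andbT.
apply/ler_addgt0Pl => e e0; rewrite addr0.
have e0' : 0 < e / (nrm v + 1) by rewrite divr_gt0 // ltr_wpDl ?nrm_ge0.
have [n [_ lt]] := dl _ e0'.
have -> : dotp l v = dotp (l - z n) v by rewrite dotpBl (oz n) // subr0.
apply: le_trans (CauchySchwarz _ _) _.
apply: (@le_trans _ _ (nrm (l - z n) * (nrm v + 1))).
  by rewrite ler_wpM2l ?nrm_ge0 // lerDl.
by rewrite -ler_pdivlMr ?ltW // ltr_wpDl ?nrm_ge0.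
Qed.

(** First-order optimality: a maximizer of [|C x| / |x|] on the orthogonal
    complement of [es] is an eigenvector of [C^* C] there. *)
Lemma maximizer_eigenvector es e : orthogonal_to es e -> nrm e = 1 ->
  (forall x, orthogonal_to es x -> nrm (C x) <= nrm (C e) * nrm x) ->
  forall x, orthogonal_to es x ->
  dotp (C x) (C e) = (nrm (C e) ^+ 2)%:C * dotp x e.
Proof.
move=> oe ne e_max x ox; set t := nrm (C e) in e_max *.
apply/eqP; rewrite eq_sym -subr_eq0 -cmod_eq0; set L := _ - _.
pose q := t ^+ 2 * nrm x ^+ 2 - nrm (C x) ^+ 2.
have sq v : orthogonal_to es v -> nrm (C v) ^+ 2 <= t ^+ 2 * nrm v ^+ 2.
  by move=> ov; rewrite -exprMn ler_pXn2r ?nnegrE ?mulr_ge0 ?nrm_ge0 ?e_max.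
have q0 : 0 <= q by rewrite subr_ge0 sq.
pose tau := (q + 1)^-1.
have tau0 : 0 < tau by rewrite invr_gt0 ltr_wpDl.
pose a := (- tau)%:C * Num.conj L.
have := sq _ (orthogonal_toD oe (orthogonal_toZ a ox)).
rewrite linearD linearZ /= !sqr_nrmD !nrmZ ne expr1n /rdot !dotpZr.
rewrite -/t !exprMn.
have ReL u v : complex.Re (Num.conj a * dotp u v) = - tau * complex.Re (L * dotp u v).
  by rewrite /a rmorphM /= conj_realc conjCK -mulrA ReMr.
rewrite !ReL; have -> : cmod a ^+ 2 = tau ^+ 2 * cmod L ^+ 2.
  by rewrite /a cmodM cmod_real cmod_conj exprMn normrN real_normK ?num_real.
have : complex.Re (L * dotp e x) * t ^+ 2 - complex.Re (L * dotp (C e) (C x)) =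
    cmod L ^+ 2.
  rewrite mulrC -ReMr -ReN -ReD.
  have -> : (t ^+ 2)%:C * (L * dotp e x) - L * dotp (C e) (C x) = L * Num.conj L.
    rewrite [dotp e x]dotpC [dotp (C e) _]dotpC mulrCA -mulrBr; congr (_ * _).
    by rewrite -[X in X * _]conj_realc -rmorphM -rmorphB.
  by rewrite mul_conj_cmod.
have tq : tau * (q + 1) = 1 by rewrite mulVf // gt_eqF // ltr_wpDl.
rewrite /q in tq.
have L0 := sqr_ge0 (cmod L).
move: (complex.Re _) (complex.Re _) (cmod L) L0 => u v w L0 w2 le.
rewrite -sqrf_eq0 eq_le L0 andbT.
have : tau * (2 * w ^+ 2) <= tau * (tau * q * w ^+ 2).
  by rewrite /q -w2 in le *; nra.
rewrite ler_pM2l // => le2.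
have : tau * q * w ^+ 2 <= 1 * w ^+ 2.
  by rewrite ler_wpM2r // -tq ler_wpM2l ?(ltW tau0) // lerDl.
by lra.
Qed.

Definition singular_family k (f : 'I_k -> H) (t : 'I_k -> R) : Prop :=
  [/\ orthonormal_family f,
      forall i, 0 <= t i /\
        forall x, dotp (C x) (C (f i)) = (t i ^+ 2)%:C * dotp x (f i) &
      forall i x, (forall i', dotp x (f i') = 0) -> nrm (C x) <= t i * nrm x].

Lemma singular_family_extend k (f : 'I_k -> H) t : singular_family f t ->
  (forall x, orthogonal_to (codom f) x -> x = 0) \/
  exists2 e, singular_family (fcons e f)
               (fun i => if unlift ord0 i is Some j then t j else nrm (C e))
  & forall x, orthogonal_to (codom f) x -> nrm (C x) <= nrm (C e) * nrm x.
Proof.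
move=> [fo ft f_max].
have [V0|Vn0] := pselect (forall x, orthogonal_to (codom f) x -> x = 0); first by left.
right.
have /compact_operator_maximizer[e [oe ne e_max]] :
    exists2 x, orthogonal_to (codom f) x & x != 0.
  apply: contrapT => noV; apply: Vn0 => x ox; apply/eqP; apply: contrapT => /negP x0.
  by apply: noV; exists x.
have ef := (orthogonal_to_codom f e).1 oe.
have e_le i : nrm (C e) <= t i by have := f_max i e ef; rewrite ne mulr1.
exists e => //; split; first exact: fcons_orthonormal.
  move=> i; case: (unliftP ord0 i) => [j|] ->.
    by rewrite fcons_lift; exact: ft.
  rewrite fcons0; split; first exact: nrm_ge0.
  move=> x; have [y [c _ <-] y_orth] := orthogonal_projection f x.
  rewrite -(subrK (lincomb c f) x); move: (x - _) y_orth => u u_orth.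
  rewrite linearD !dotpDl (maximizer_eigenvector oe ne e_max); last first.
    exact/orthogonal_to_codom.
  have -> : dotp (lincomb c f) e = 0.
    by apply: dotp_eq0C; apply: (dotp_spanned ef); exists c.
  suff -> : dotp (C (lincomb c f)) (C e) = 0 by rewrite !addr0.
  apply: dotp_eq0C; rewrite linear_lincomb.
  apply: (@dotp_spanned _ _ _ (fun i => C (f i))); last by exists c.
  by move=> j; rewrite (ft j).2 ef mulr0.
move=> i x xf.
have ox : orthogonal_to (codom f) x.
  by apply/orthogonal_to_codom => j; have := xf (lift ord0 j); rewrite fcons_lift.
apply: le_trans (e_max x ox) _; rewrite ler_wpM2r ?nrm_ge0 //.
by case: (unliftP ord0 i).
Qed.

(** The greedy construction of the singular vectors; it stops early only when the
    vectors found so far exhaust the space. *)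
Lemma singular_family_exists k :
  (exists2 es, (size es <= k)%N & forall x, orthogonal_to es x -> x = 0) \/
  exists (f : 'I_k -> H) (t : 'I_k -> R), singular_family f t.
Proof.
elim: k => [|k [[es es_k es0]|[f [t ft]]]].
- by right; exists (fun=> 0), (fun=> 0); split=> [[]|[]|[]].
- by left; exists es => //; exact: leqW.
have [V0|[e fet _]] := singular_family_extend ft.
  by left; exists (codom f) => //; rewrite size_codom card_ord.
by right; exists (fcons e f); eexists; exact: fet.
Qed.

(** If [C e] has no adjoint image, then the default value 0 forces [t = 0], so the
    bound holds whether or not adjoints exist. *)
Lemma singular_vector_le (t : R) e (s : R) : (forall x, nrm (C x) <= s * nrm x) ->
  nrm e = 1 -> singular_vector C t e -> t <= s.
Proof.
move=> Cs ne [t0 Ce]; have := Cs e; rewrite ne mulr1 => Ces.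
have s0 : 0 <= s := le_trans (nrm_ge0 _) Ces.
have [[z zP]|noadj] := pselect (exists z, forall x, dotp (C x) (C e) = dotp x z).
  have adjP : forall x, dotp (C x) (C e) = dotp x (adjoint C (C e)).
    exact: (@xgetPex _ 0 [set z | forall x, dotp (C x) (C e) = dotp x z]
             (ex_intro _ z zP)).
  have := adjP e; rewrite Ce dotpZr conj_realc !dotpp ne expr1n rmorph1 mulr1.
  move=> /complexI /eqP; rewrite eqrXn2 ?nrm_ge0 // => /eqP <-.
  exact: Ces.
have adj0 : adjoint C (C e) = 0.
  rewrite /adjoint xgetPN // => z zP; apply: noadj; exists z; exact: zP.
move: Ce; rewrite adj0 => /(congr1 (@nrm R H)); rewrite nrm0 nrmZ ne mulr1.
rewrite cmod_real ger0_norm ?sqr_ge0 // => /esym/eqP.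
by rewrite sqrf_eq0 => /eqP ->.
Qed.

Lemma singular_vectorI (t : R) e : 0 <= t ->
  (forall x, dotp (C x) (C e) = (t ^+ 2)%:C * dotp x e) -> singular_vector C t e.
Proof.
move=> t0 Ce; split=> //.
have teP x : dotp (C x) (C e) = dotp x ((t ^+ 2)%:C *: e).
  by rewrite dotpZr conj_realc Ce.
have adjP : forall x, dotp (C x) (C e) = dotp x (adjoint C (C e)).
  exact: (@xgetPex _ 0 [set z | forall x, dotp (C x) (C e) = dotp x z]
           (ex_intro _ _ teP)).
apply/eqP; rewrite -subr_eq0 -nrm_eq0 -sqrf_eq0; apply/eqP/complexI.
by rewrite -dotpp dotpBr -adjP -teP subrr.
Qed.

Lemma le_singular_value k (f : 'I_k.+1 -> H) (t : 'I_k.+1 -> R) (s : R) : 0 <= s ->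
  orthonormal_family f -> (forall i, singular_vector C (t i) (f i)) ->
  (forall i, s <= t i) -> s <= singular_value C k.+1.
Proof.
move=> s0 fo ft st; apply: ub_le_sup; last by split=> //; exists t, f.
have [b _ Cb] := compact_operator_bounded.
exists b => u [_ [t' [f' [fo' ft' ut]]]].
apply: le_trans (ut ord0) (singular_vector_le Cb _ (ft' ord0)).
exact: nrm_orthonormal.
Qed.

(** The half of the Courant-Fischer principle that bounds [C] from above. *)
Lemma singular_value_codim k : exists2 es, (size es <= k)%N &
  forall x, orthogonal_to es x -> nrm (C x) <= singular_value C k.+1 * nrm x.
Proof.
have [[es es_k es0]|[f [t ft]]] := singular_family_exists k.
  by exists es => // x /es0 ->; rewrite linear0 !nrm0 mulr0.
exists (codom f); first by rewrite size_codom card_ord.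
have [V0|[e [feo fet fe_max] e_max]] := singular_family_extend ft.
  by move=> x /V0 ->; rewrite linear0 !nrm0 mulr0.
move=> x /e_max le; apply: le_trans le _; rewrite ler_wpM2r ?nrm_ge0 //.
apply: (le_singular_value (nrm_ge0 _) feo) => i.
  by have [t0 Ce] := fet i; apply: singular_vectorI t0 Ce.
have ne : nrm e = 1 by have := nrm_orthonormal ord0 feo; rewrite fcons0.
have ef i' : dotp e (f i') = 0.
  by have := feo ord0 (lift ord0 i'); rewrite fcons0 fcons_lift.
case: (unliftP ord0 i) => [j|] _ //.
by case: ft => _ _ /(_ j e ef); rewrite ne mulr1.
Qed.

Lemma singular_value_ge0 k : 0 <= singular_value C k.
Proof.
rewrite /singular_value; set A := [set s | _].
have [A_sup|/sup_out -> //] := pselect (has_sup A).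
by have [[s As] ub] := A_sup; apply: le_trans As.1 (ub_le_sup ub As).
Qed.

End CompactOperators.

(** * Orthonormal bases adapted to a flag of conditions *)

Section FlagBasis.
Context {R : realType} {H : hilbertType R}.
Implicit Types (x y z e : H) (a b : R[i]) (k m : nat) (es : seq H).

Lemma mxfam1 k (v : 'I_k -> H) : mxfam 1%:M v = v.
Proof.
apply/funext => i; rewrite /mxfam /lincomb (bigD1 i) //= mxE eqxx scale1r.
by rewrite big1 ?addr0 // => j ji; rewrite mxE eq_sym (negbTE ji) scale0r.
Qed.

Lemma mxfamM m n k (S : 'M[R[i]]_(m, n)) (T : 'M[R[i]]_(n, k)) (v : 'I_k -> H) :
  mxfam S (mxfam T v) = mxfam (S *m T) v.
Proof.
apply/funext => i; rewrite /mxfam /lincomb.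
under eq_bigr do rewrite scaler_sumr.
rewrite exchange_big; apply: eq_bigr => j _ /=.
by rewrite mxE scaler_suml; apply: eq_bigr => l _; rewrite scalerA.
Qed.

Lemma lincomb_eq0 k (v : 'I_k -> H) (c : 'rV[R[i]]_k) :
  \det (gram v) != 0 -> lincomb (c 0) v = 0 -> c = 0.
Proof.
move=> v_free cv0; apply/eqP; apply: contraNT v_free => c0.
apply/det0P; exists c => //; apply/rowP => j; rewrite !mxE.
rewrite -[RHS](dotp0l (v j)) -cv0 dotp_suml; apply: eq_bigr => i _.
by rewrite mxE dotpZl.
Qed.

(** Fewer linear conditions than dimensions leave a nonzero solution. *)
Lemma exists_orthogonal k (v : 'I_k -> H) (L : {linear H -> H}) es gs :
  \det (gram v) != 0 -> (size es + size gs < k)%N ->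
  exists2 w, spanned v w &
    [/\ nrm w = 1, orthogonal_to es (L w) & orthogonal_to gs w].
Proof.
move=> v_free lt_k.
pose A : 'M[R[i]]_(k, size es) := \matrix_(i, j) dotp (L (v i)) es`_j.
pose G : 'M[R[i]]_(k, size gs) := \matrix_(i, j) dotp (v i) gs`_j.
have : kermx (row_mx A G) != 0.
  by rewrite -mxrank_eq0 mxrank_ker subn_eq0 -ltnNge (leq_ltn_trans (rank_leq_col _)).
move=> /rowV0Pn[c /sub_kermxP cAG c0].
move: cAG; rewrite mul_mx_row => /eqP; rewrite row_mx_eq0 => /andP[/eqP cA /eqP cG].
pose w0 := lincomb (c 0) v.
have w00 : w0 != 0 by apply: contraNneq c0 => /(lincomb_eq0 v_free) ->.
exists ((nrm w0)^-1%:C *: w0); first by apply: spannedZ; exists (c 0).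
split; first exact: nrm_normalize.
  rewrite linearZ; apply: orthogonal_toZ => e /(nthP 0)[j je <-].
  rewrite linear_lincomb dotp_suml.
  move/matrixP/(_ 0 (Ordinal je)): cA; rewrite !mxE => cA; rewrite -[RHS]cA.
  by apply: eq_bigr => i _; rewrite mxE dotpZl.
apply: orthogonal_toZ => e /(nthP 0)[j je <-].
rewrite dotp_suml.
move/matrixP/(_ 0 (Ordinal je)): cG; rewrite !mxE => cG; rewrite -[RHS]cG.
by apply: eq_bigr => i _; rewrite mxE dotpZl.
Qed.

(** Choosing the last vector first, the [j]-th vector meets at most [j] linear
    conditions and [k - j - 1] orthogonality relations, in dimension [k]. *)
Lemma exists_flag_basis k (v : 'I_k -> H) (L : {linear H -> H}) (es : nat -> seq H) :
  \det (gram v) != 0 -> (forall j, (size (es j) <= j)%N) ->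
  exists2 T : 'M[R[i]]_k, orthonormal_family (mxfam T v) &
    forall j : 'I_k, orthogonal_to (es j) (L (mxfam T v j)).
Proof.
move=> v_free es_size.
have : forall m, (m <= k)%N -> exists f : 'I_m -> H, [/\ orthonormal_family f,
    forall i, spanned v (f i) &
    forall i : 'I_m, orthogonal_to (es (k - m + i)%N) (L (f i))].
  elim=> [_|m IHm m_k]; first by exists (fun=> 0); split=> [[]|[]|[]].
  have [f [fo fv fL]] := IHm (ltnW m_k).
  have [|w vw [nw wL wf]] :=
      @exists_orthogonal _ v L (es (k - m.+1)%N) (codom f) v_free.
    rewrite size_codom card_ord -ltn_subRL ltn_subRL.
    by rewrite (leq_ltn_trans (leq_add (es_size _) (leqnn m))) // -addnS subnK.
  exists (fcons w f); split.
  - by apply: fcons_orthonormal => // i; apply: wf; exact: codom_f.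
  - by move=> i; case: (unliftP ord0 i) => [j|] ->; rewrite ?fcons_lift ?fcons0.
  - move=> i; case: (unliftP ord0 i) => [j|] ->; last first.
      by rewrite fcons0 addn0.
    rewrite fcons_lift lift0 addnS -addSn -subSn // subSS; exact: fL.
move=> /(_ k (leqnn k))[f [fo fv fL]].
have /choice[c cP] : forall i, exists c, lincomb c v = f i.
  by move=> i; have [c _ cf] := fv i; exists c.
pose T : 'M[R[i]]_k := \matrix_(i, j) c i j.
have TE : mxfam T v = f.
  apply/funext => i; rewrite -cP; congr lincomb.
  by apply/funext => j; rewrite mxE.
exists T; rewrite TE // => j.
by have := fL j; rewrite subnn.
Qed.

Lemma spanned_orthonormal_mxfam k (v : 'I_k -> H) (T : 'M[R[i]]_k) :
  orthonormal_family (mxfam T v) -> forall i, spanned (mxfam T v) (v i).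
Proof.
move=> fo i.
have T_unit : T \in unitmx.
  rewrite unitmxE unitfE; apply/eqP => T0.
  have := det_gram_mxfam T v; rewrite gram_orthonormal // det1 T0 cmod0 expr0n.
  by rewrite mul0r => /eqP; rewrite oner_eq0.
by exists (invmx T i) => //; rewrite -/(mxfam _ _ i) mxfamM mulVmx // mxfam1.
Qed.

End FlagBasis.

(** * GMRES for a compact perturbation *)

Section PerturbedGMRES.
Context {R : realType} {H : hilbertType R}.
Variables (A Ainv B Binv C : {linear H -> H}).
Hypothesis Bbd : bounded_operator B.
Hypothesis BinvP : bounded_inverse B Binv.
Hypothesis Ccpt : compact_operator C.
Hypothesis ABC : forall x : H, A x = B x + C x.
Hypothesis AinvP : bounded_inverse A Ainv.
Implicit Types (r w x y z : H) (a b : R[i]) (k n : nat).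

Let M := reduction_factor B.

Let M_ge0 : 0 <= M. Proof. exact: reduction_factor_ge0. Qed.

Lemma inverse_near_scalar w : exists b, nrm (w - b *: Binv w) <= M * nrm w.
Proof.
have [_ BK BinvK] := BinvP.
have [Sw0|Sw0] := eqVneq (Binv w) 0.
  have -> : w = 0 by rewrite -(BinvK w) Sw0 linear0.
  by exists 0; rewrite scale0r subr0 nrm0 mulr0.
apply: near_collinear_sym => //.
have [a] := reduction_factor_step B (Binv w).
by rewrite BinvK => le; exists a.
Qed.

(** The resolvent identity [A^-1 = B^-1 - A^-1 C B^-1]. *)
Lemma inverse_perturbation b w :
  w - b *: Ainv w = (w - b *: Binv w) + Ainv (C (b *: Binv w)).
Proof.
have [_ BK BinvK] := BinvP; have [_ AK AinvK] := AinvP.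
have -> : Ainv (C (b *: Binv w)) = b *: Binv w - b *: Ainv w.
  rewrite [C _]linearZ_LR [Ainv (b *: _)]linearZ_LR -scalerBr; congr (_ *: _).
  have -> : C (Binv w) = A (Binv w) - w by rewrite ABC BinvK addrAC subrr add0r.
  by rewrite linearB AK.
by rewrite addrA subrK.
Qed.

Lemma nrm_inverse_perturbation b w : nrm (w - b *: Binv w) <= M * nrm w ->
  nrm (w - b *: Ainv w) <= M * nrm w + opnorm Ainv * nrm (C (b *: Binv w)).
Proof.
move=> wb; have [Ainv_bd _ _] := AinvP.
rewrite inverse_perturbation; apply: le_trans (nrmD _ _) _.
by rewrite lerD // opnorm_bound.
Qed.

Lemma nrm_scaled_inverse b w : nrm (w - b *: Binv w) <= M * nrm w ->
  nrm (b *: Binv w) <= (1 + M) * nrm w.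
Proof.
move=> wb; rewrite -{1}(subKr w (b *: Binv w)).
by apply: le_trans (nrmB _ _) _; rewrite mulrDl mul1r lerD2l.
Qed.

Lemma inverse_lower_bound : exists2 s0 : R, 0 < s0 & forall x, s0 * nrm x <= nrm (Binv x).
Proof.
have [_ BK BinvK] := BinvP; have [s s_gt0 Bs] := bounded_operatorP Bbd.
exists s^-1; first by rewrite invr_gt0.
by move=> x; rewrite ler_pdivrMl // -{1}(BinvK x).
Qed.

Theorem gmres_residual_le_prod r k :
  nrm (gmres_residual A r k) <=
  nrm r * \prod_(i < k) (M + (1 + M) * opnorm Ainv * singular_value C i.+1).
Proof.
have [Binv_bd BK BinvK] := BinvP; have [Ainv_bd AK AinvK] := AinvP.
have factor_ge0 i : 0 <= M + (1 + M) * opnorm Ainv * singular_value C i.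
  by rewrite addr_ge0 // !mulr_ge0 ?addr_ge0 ?opnorm_ge0 ?singular_value_ge0.
pose v := krylov_image A r (k := k).
have [v_dep|v_free] := eqVneq (\det (gram v)) 0.
  rewrite (krylov_dependent AK v_dep) nrm0 mulr_ge0 ?nrm_ge0 //.
  by apply: prodr_ge0 => i _; exact: factor_ge0.
have [s0 s0_gt0 s0P] := inverse_lower_bound.
(* The scalar must not depend on the vector: w - b B^-1 w has to be a linear
   function of w for the determinant argument. *)
have [T0 f0o _] := @exists_flag_basis _ _ _ v idfun (fun=> [::]) v_free (fun=> isT).
have [b b_unif] := uniform_scalar f0o M_ge0 s0_gt0 s0P Binv_bd inverse_near_scalar.
have bP w : spanned v w -> nrm (w - b *: Binv w) <= M * nrm w.
  move=> vw; apply: b_unif; apply: spanned_sub vw.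
  exact: spanned_orthonormal_mxfam.
have /choice[es esP] : forall j, exists es, (size es <= j)%N /\
    forall x, orthogonal_to es x -> nrm (C x) <= singular_value C j.+1 * nrm x.
  by move=> j; have [es] := singular_value_codim Ccpt j; exists es.
have es_size j : (size (es j) <= j)%N := (esP j).1.
have [T fo f_flag] := @exists_flag_basis _ _ _ v (b \*: Binv) es v_free es_size.
apply: le_trans (gmres_residual_prod AK b fo) _.
rewrite ler_wpM2l ?nrm_ge0 //; apply: ler_prod => i _; rewrite nrm_ge0 /=.
set f := mxfam T v i.
have vf : spanned v f by exists (T i).
have nf : nrm f = 1 by exact: nrm_orthonormal.
apply: le_trans (nrm_inverse_perturbation (bP _ vf)) _; rewrite nf mulr1 lerD2l.
rewrite [(1 + M) * _]mulrC -mulrA ler_wpM2l ?opnorm_ge0 //.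
apply: le_trans ((esP i).2 _ (f_flag i)) _.
rewrite mulrC ler_wpM2r ?singular_value_ge0 //.
by have := nrm_scaled_inverse (bP _ vf); rewrite nf mulr1.
Qed.

(** Bessel's inequality for the bounded functional [x |-> <T x, y>]. *)
Lemma orthonormal_bessel_small (T : {linear H -> H}) (s : R) (w : nat -> H) y :
  (forall x, nrm (T x) <= s * nrm x) ->
  (forall i j, dotp (w i) (w j) = (i == j)%:R) ->
  forall e : R, 0 < e -> exists N, forall n, (N <= n)%N -> cmod (dotp (T (w n)) y) < e.
Proof.
move=> Ts wo e e0.
pose u n := cmod (dotp (T (w n)) y) ^+ 2.
have u0 n : 0 <= u n by exact: sqr_ge0.
have u_sum n : \sum_(0 <= i < n) u i <= (s * nrm y) ^+ 2.
  rewrite big_mkord; pose f (i : 'I_n) := w i.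
  have fo : orthonormal_family f by move=> i j; rewrite /f wo.
  pose c (i : 'I_n) := Num.conj (dotp (T (w i)) y).
  set K := \sum_(i < n) u i.
  have K0 : 0 <= K by apply: sumr_ge0.
  have nK : nrm (lincomb c f) ^+ 2 = K.
    by rewrite sqr_nrm_lincomb //; apply: eq_bigr => i _; rewrite cmod_conj.
  have TK : dotp (T (lincomb c f)) y = K%:C.
    rewrite linear_lincomb dotp_suml rmorph_sum; apply: eq_bigr => i _.
    by rewrite dotpZl mulrC mul_conj_cmod.
  have := CauchySchwarz (T (lincomb c f)) y.
  rewrite TK cmod_real ger0_norm // => le.
  have {}le : K <= nrm (lincomb c f) * (s * nrm y).
    apply: le_trans le _; rewrite mulrCA mulrA ler_wpM2r ?nrm_ge0 //.
  have sy : 0 <= s * nrm y by apply: le_trans (Ts y); exact: nrm_ge0.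
  move: le; rewrite -nK expr2; have [->|nz] := eqVneq (nrm (lincomb c f)) 0.
    by rewrite mul0r sqr_ge0.
  rewrite ler_pM2l ?lt_def ?nz ?nrm_ge0 // => le.
  by rewrite -expr2 ler_pXn2r ?nnegrE ?nrm_ge0.
have u_cvg : u n @[n --> \oo] --> (0 : R).
  apply: cvg_series_cvg_0; apply: nondecreasing_is_cvgn.
    by apply/nondecreasing_seqP => n; rewrite /series /= big_nat_recr //= lerDl.
  by exists ((s * nrm y) ^+ 2) => _ [n _ <-]; exact: u_sum.
have e2 : 0 < e ^+ 2 by rewrite exprn_gt0.
have /cvgrPdist_lt/(_ _ e2)[N _ NP] := u_cvg.
exists N => n /NP; rewrite sub0r normrN ger0_norm // /u.
by rewrite ltr_pXn2r ?nnegrE ?cmod_ge0 // ltW.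
Qed.

(** Orthonormal vectors tend weakly to 0, hence so do their images under [C B^-1],
    which by compactness would otherwise have a nonzero cluster point. *)
Lemma compact_orthonormal_small (w : nat -> H) :
  (forall i j, dotp (w i) (w j) = (i == j)%:R) ->
  forall e : R, 0 < e ->
    exists N, forall n, (N <= n)%N -> nrm (C (Binv (w n))) < e.
Proof.
move=> wo e e0; have [Binv_bd _ _] := BinvP.
have [s s0 Bs] := bounded_operatorP Binv_bd.
have [c c0 Cs] := compact_operator_bounded Ccpt.
have nw n : nrm (w n) = 1.
  apply/eqP; rewrite -(eqrXn2 (n := 2)) ?nrm_ge0 // expr1n.
  by apply/eqP/complexI; rewrite -dotpp wo eqxx.
apply: contrapT => noN.
have /choice[f fP] : forall N, exists n, (N <= n)%N /\ e <= nrm (C (Binv (w n))).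
  move=> N; apply: contrapT => noN'; apply: noN; exists N => n Nn.
  by rewrite ltNge; apply/negP => le; apply: noN'; exists n.
pose x n := (s^-1)%:C *: Binv (w (f n)).
have sV : cmod (s^-1)%:C = s^-1 by rewrite cmod_real gtr0_norm // invr_gt0.
have [|y y_cl] := compact_operator_cluster Ccpt (x := x).
  move=> n; rewrite /x nrmZ sV ler_pdivrMl // mulr1.
  by apply: le_trans (Bs _) _; rewrite nw mulr1.
have Cx n : e / s <= nrm (C (x n)).
  by rewrite /x linearZ nrmZ sV mulrC ler_wpM2l ?invr_ge0 ?(ltW s0) ?(fP n).2.
pose d := e / s; have d0 : 0 < d by rewrite divr_gt0.
have ny : d <= nrm y.
  apply/ler_addgt0Pr => h h0; have [n _ lt] := y_cl h 0%N h0.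
  have := nrmD (C (x n) - y) y; rewrite subrK; have := Cx n; rewrite -/d.
  by lra.
have ny0 : 0 < nrm y := lt_le_trans d0 ny.
have T_bd z : nrm ((C \o Binv) z) <= c * s * nrm z.
  by apply: le_trans (Cs _) _; rewrite -mulrA ler_wpM2l ?(ltW c0) ?Bs.
have q0 : 0 < s * (nrm y ^+ 2 / 2) by rewrite mulr_gt0 // divr_gt0 // exprn_gt0.
have [N NP] := orthonormal_bessel_small y T_bd wo q0.
have y20 : 0 < nrm y / 2 by rewrite divr_gt0.
have [n Nn lt] := y_cl _ N y20.
have le1 : cmod (dotp (C (x n)) y) < nrm y ^+ 2 / 2.
  have := NP (f n) (leq_trans Nn (fP n).1).
  by rewrite /x linearZ dotpZl cmodM sV ltr_pdivrMl.
have le2 : nrm y ^+ 2 <= cmod (dotp (C (x n)) y) + nrm (C (x n) - y) * nrm y.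
  have -> : nrm y ^+ 2 = cmod (dotp y y).
    by rewrite dotpp cmod_real ger0_norm // sqr_ge0.
  have -> : dotp y y = dotp (C (x n)) y - dotp (C (x n) - y) y.
    by rewrite dotpBl subKr.
  apply: le_trans (cmodD _ _) _; rewrite cmodN lerD2l.
  exact: CauchySchwarz.
have le3 : nrm (C (x n) - y) * nrm y <= nrm y / 2 * nrm y.
  by rewrite ler_wpM2r ?nrm_ge0 // ltW.
have : nrm y / 2 * nrm y = nrm y ^+ 2 / 2 by ring.
by lra.
Qed.

Section Arnoldi.
Variable r : H.
Hypothesis r_free : forall k, gmres_residual A r k != 0.

(** The last vector of the Gram-Schmidt process on [A r, ..., A^(n+1) r]. *)
Lemma arnoldi_vector n : exists w, [/\ spanned (krylov_image A r (k := n.+1)) w,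
  forall x, spanned (krylov_image A r (k := n)) x -> dotp w x = 0 & nrm w = 1].
Proof.
have [_ AK _] := AinvP.
pose vn := krylov_image A r (@ord_max n).
have [y vy y_orth] := orthogonal_projection (krylov_image A r (k := n)) vn.
have vw : spanned (krylov_image A r (k := n.+1)) (vn - y).
  apply: spannedB; first exact: (spanned_mem _ ord_max).
  exact: krylov_image_sub vy.
have w0 : vn - y != 0.
  apply/eqP => w0; have vnE : vn = y by apply/eqP; rewrite -subr_eq0 w0.
  have := r_free n.+1; rewrite (krylov_dependent AK) ?eqxx //.
  have [c _ cy] := vy.
  apply/eqP/det0P.
  exists (\row_(i < n.+1) (if unlift ord_max i is Some j then - c j else 1)).
    apply/eqP => /rowP/(_ ord_max); rewrite !mxE unlift_none => /eqP.
    by rewrite oner_eq0.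
  apply/rowP => j; rewrite !mxE big_ord_recr /= !mxE unlift_none mul1r -/vn vnE -cy.
  rewrite dotp_suml addrC -[RHS](subrr (\sum_i dotp (c i *: krylov_image A r i)
    (krylov_image A r j))) -sumrN; congr (_ + _).
  apply: eq_bigr => i _.
  have -> : widen_ord (leqnSn n) i = lift ord_max i.
    exact/val_inj/esym/lift_max.
  by rewrite !mxE liftK mulNr dotpZl /krylov_image lift_max.
exists ((nrm (vn - y))^-1%:C *: (vn - y)); split; first exact: spannedZ.
  by move=> x vx; rewrite dotpZl (dotp_spanned y_orth vx) mulr0.
exact: nrm_normalize.
Qed.

(** The ratio is at most the sine of the angle between [w] and [r_n]. As [A^-1 w]
    lies in the span of [r_n] and [A K_n], the right-hand side is at least the
    distance from [w] to the line of [r_n], which is the same sine. *)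
Lemma gmres_residual_ratio_le w n b :
  spanned (krylov_image A r (k := n.+1)) w ->
  (forall x, spanned (krylov_image A r (k := n)) x -> dotp w x = 0) -> nrm w = 1 ->
  residual_ratio A r n.+1 <= nrm (w - b *: Ainv w).
Proof.
have [_ AK _] := AinvP.
move=> vw w_orth nw; rewrite /residual_ratio /=.
set rn := gmres_residual A r n.
have [z vz [rnE rn_orth]] := gmres_residualP A r n; rewrite -/rn in rnE rn_orth.
have rn0 : rn != 0 by exact: r_free.
have nrn : 0 < nrm rn by rewrite nrm_gt0.
have [c [y vy wE]] : exists c, exists2 y, spanned (krylov_image A r (k := n)) y &
    Ainv w = c *: rn + y.
  have [c _ <-] := vw; exists (c ord0).
  exists (c ord0 *: z + \sum_(i < n) c (lift ord0 i) *: krylov_image A r i).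
    apply: spannedD; first exact: spannedZ.
    by exists (fun i => c (lift ord0 i)).
  rewrite linear_lincomb /lincomb big_ord_recl /= AK addrA -scalerDr rnE subrK.
  congr (_ + _); apply: eq_bigr => i _; congr (_ *: _).
  by rewrite /krylov_image lift0 /= AK.
rewrite ler_pdivrMr // -(ler_pXn2r (n := 2)) ?nnegrE ?mulr_ge0 ?nrm_ge0 //.
have le1 : nrm (gmres_residual A r n.+1) ^+ 2 <=
    nrm rn ^+ 2 - cmod (dotp rn w) ^+ 2.
  apply: (@le_trans _ _ (nrm (rn - dotp rn w *: w) ^+ 2)).
    rewrite ler_pXn2r ?nnegrE ?nrm_ge0 // rnE -addrA -opprD.
    apply: gmres_residual_min; apply: spannedD; last exact: spannedZ.
    exact: krylov_image_sub vz.
  have w0 : w != 0 by rewrite -nrm_eq0 nw oner_eq0.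
  have := sqr_nrm_proj rn w0; rewrite dotpp nw expr1n rmorph1 !divr1 => ->.
  by rewrite lexx.
have le2 : nrm w ^+ 2 - cmod (dotp w rn) ^+ 2 / nrm rn ^+ 2 <=
    nrm (w - b *: Ainv w) ^+ 2.
  apply: le_trans (sqr_nrm_proj_le (b * c) w rn0) _.
  have -> : w - b *: Ainv w = (w - (b * c) *: rn) + (- b) *: y.
    by rewrite wE scalerDr scalerA opprD addrA scaleNr.
  rewrite [leRHS]sqr_nrm_pythag ?lerDl ?sqr_ge0 //.
  rewrite dotpZr dotpBl w_orth // dotpZl (dotp_spanned rn_orth vy).
  by rewrite mulr0 subrr mulr0.
apply: le_trans le1 _; rewrite exprMn.
apply: le_trans (ler_wpM2r (sqr_ge0 (nrm rn)) le2).
rewrite nw expr1n mulrBl mul1r divfK ?gt_eqF ?exprn_gt0 //.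
by rewrite dotpC cmod_conj.
Qed.

Lemma residual_ratio_eventually (e : R) : 0 < e ->
  exists N, forall n, (N <= n)%N -> residual_ratio A r n <= M + e.
Proof.
move=> e0; have /choice[w wP] := arnoldi_vector.
have wo i j : dotp (w i) (w j) = (i == j)%:R.
  have lt_orth m n : (m < n)%N -> dotp (w n) (w m) = 0.
    move=> mn; have [_ w_orth _] := wP n; apply: w_orth.
    by have [wm _ _] := wP m; exact: krylov_image_sub wm.
  have [ij|ji|->] := ltngtP i j.
  - by apply: dotp_eq0C; exact: lt_orth.
  - exact: lt_orth.
  - by have [_ _ nw] := wP j; rewrite dotpp nw expr1n.
have [s0 s0_gt0 s0P] := inverse_lower_bound.
pose D := opnorm Ainv * ((1 + M) / s0) + 1.
have D0 : 0 < D.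
  by rewrite ltr_wpDl // mulr_ge0 ?opnorm_ge0 // divr_ge0 ?addr_ge0 // ltW.
have [N NP] := compact_orthonormal_small wo (divr_gt0 e0 D0).
exists N.+1 => -[//|n]; rewrite ltnS => Nn.
have [wn w_orth nw] := wP n; have [b bP] := inverse_near_scalar (w n).
apply: le_trans (gmres_residual_ratio_le b wn w_orth nw) _.
apply: le_trans (nrm_inverse_perturbation bP) _; rewrite nw mulr1 lerD2l.
have b_le : cmod b <= (1 + M) / s0.
  rewrite ler_pdivlMr //; have := nrm_scaled_inverse bP; rewrite nrmZ nw mulr1.
  by apply: le_trans; rewrite ler_wpM2l ?cmod_ge0 // -[s0]mulr1 -nw.
have -> : C (b *: Binv (w n)) = b *: C (Binv (w n)) by rewrite linearZ.
rewrite nrmZ mulrA; apply: (@le_trans _ _ (D * (e / D))); last first.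
  by rewrite mulrC divfK // gt_eqF.
apply: ler_pM; rewrite ?mulr_ge0 ?opnorm_ge0 ?cmod_ge0 ?nrm_ge0 //; last first.
  by rewrite ltW // NP.
rewrite /D; apply: le_trans (_ : opnorm Ainv * ((1 + M) / s0) <= _).
  by rewrite ler_wpM2l ?opnorm_ge0.
by rewrite lerDl.
Qed.

End Arnoldi.

Theorem limn_esup_residual_ratio r :
  (limn_esup (fun k : nat => (residual_ratio A r k)%:E) <= M%:E)%E.
Proof.
have eventually_le e : 0 < e ->
    exists N, forall n, (N <= n)%N -> residual_ratio A r n <= M + e.
  move=> e0; have [r_free|] := pselect (forall k, gmres_residual A r k != 0).
    exact: residual_ratio_eventually.
  move=> /existsNP[k /negP]; rewrite negbK => /eqP rk0.
  exists k => n kn; rewrite /residual_ratio.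
  have -> : nrm (gmres_residual A r n) = 0.
    apply/eqP; rewrite eq_le nrm_ge0 andbT.
    by rewrite (le_trans (gmres_residual_noninc A r kn)) // rk0 nrm0.
  by rewrite mul0r addr_ge0 // ltW.
apply/lee_addgt0Pr => e e0; have [N NP] := eventually_le e e0.
rewrite /limn_esup /limf_esup; apply: le_trans (_ : _ <= ereal_sup
  [set (residual_ratio A r n)%:E | n in [set n | (N <= n)%N]])%E _.
  apply: ereal_inf_lbound; exists [set n | (N <= n)%N] => //.
  by exists N.
apply: ge_ereal_sup => _ [n Nn <-].
by rewrite -EFinD lee_fin NP.
Qed.

End PerturbedGMRES.

(** * From products to means *)

Section Means.
Context {R : realType}.
Implicit Types (k : nat) (p : R).

(** Young's inequality applied to [s i / m] and 1, summed over [i]. *)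
Lemma sum_le_power_mean k (s : 'I_k -> R) p (m : R) : 1 <= p -> 0 <= m ->
  (forall i, 0 <= s i) -> \sum_i s i `^ p <= k%:R * m `^ p ->
  \sum_i s i <= k%:R * m.
Proof.
move=> p1 m0 s0 le.
have p0 : 0 < p := lt_le_trans ltr01 p1.
have [m_eq0|mn0] := eqVneq m 0.
  rewrite m_eq0 powR0 ?gt_eqF // mulr0 in le.
  have s_p i : s i `^ p = 0.
    apply/eqP; rewrite eq_le powR_ge0 andbT.
    apply: le_trans le; rewrite (bigD1 i) //= lerDl.
    by apply: sumr_ge0 => j _; exact: powR_ge0.
  rewrite m_eq0 mulr0 big1 // => i _.
  by have /eqP := s_p i; rewrite powR_eq0 => /andP[/eqP].
have m_gt0 : 0 < m by rewrite lt_def mn0.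
have [p1'|pn1] := eqVneq p 1.
  by move: le; rewrite p1' powRr1 //; under eq_bigr do rewrite powRr1 //.
have p_gt1 : 1 < p by rewrite lt_neqAle eq_sym pn1.
pose q := p / (p - 1).
have pm1 : 0 < p - 1 by rewrite subr_gt0.
have q0 : 0 < q by rewrite divr_gt0.
have pq : p^-1 + q^-1 = 1 by rewrite /q; field; rewrite !gt_eqF.
have young i : s i / m <= s i `^ p / m `^ p / p + q^-1.
  have := @conjugate_powR _ (s i / m) 1 p q (divr_ge0 (s0 i) m0) ler01 p0 q0 pq.
  rewrite mulr1 powR1 div1r powRM ?invr_ge0 //.
  suff -> : m^-1 `^ p = (m `^ p)^-1 by [].
  by rewrite -(powR_inv1 m0) -powRrM mulN1r powRN.
have mp : 0 < m `^ p by exact: powR_gt0.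
rewrite -ler_pdivrMr // mulr_suml.
apply: le_trans (ler_sum _ (fun i _ => young i)) _.
rewrite big_split /= sumr_const card_ord -!mulr_suml.
have -> : k%:R = k%:R * p^-1 + k%:R * q^-1 by rewrite -mulrDr pq mulr1.
rewrite -[_ *+ k]mulr_natl lerD2r.
by rewrite ler_pM2r ?invr_gt0 // ler_pdivrMr.
Qed.

Lemma prod_le_mean k (F : 'I_k -> R) : (forall i, 0 <= F i) ->
  \prod_i F i <= ((\sum_i F i) / k%:R) ^+ k.
Proof.
move=> F0; have := @leif_AGM _ 'I_k predT F (fun i _ => F0 i).
by rewrite card_ord => -[].
Qed.

Lemma root_prod_le k (x M c p tau : R) (s : 'I_k -> R) : (0 < k)%N ->
  0 <= x -> 0 <= M -> 0 <= c -> 1 <= p -> 0 <= tau ->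
  (forall i, 0 <= s i) -> \sum_i s i `^ p <= tau ->
  x <= \prod_i (M + c * s i) ->
  x `^ k%:R^-1 <= M + k%:R `^ (- p^-1) * c * tau `^ p^-1.
Proof.
move=> k0 x0 M0 c0 p1 tau0 s0 s_tau x_le.
have p0 : 0 < p := lt_le_trans ltr01 p1.
have kR : 0 < k%:R :> R by rewrite ltr0n.
pose m := k%:R `^ (- p^-1) * tau `^ p^-1.
have m0 : 0 <= m by rewrite mulr_ge0 ?powR_ge0.
have mp : k%:R * m `^ p = tau.
  have -> : m `^ p = (k%:R `^ (- p^-1)) `^ p * (tau `^ p^-1) `^ p.
    by apply: powRM; exact: powR_ge0.
  rewrite -!powRrM mulNr mulVf ?gt_eqF // powRN !powRr1 //.
  by rewrite mulrA mulfV ?mul1r // gt_eqF.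
have -> : k%:R `^ (- p^-1) * c * tau `^ p^-1 = c * m by rewrite /m mulrAC mulrC.
clearbody m.
have s_m : \sum_i s i <= k%:R * m by apply: (sum_le_power_mean p1) => //; rewrite mp.
have F0 i : 0 <= M + c * s i by rewrite addr_ge0 // mulr_ge0.
have xk : x <= (M + c * m) ^+ k.
  apply: le_trans x_le _; apply: le_trans (prod_le_mean F0) _.
  rewrite ler_pXn2r ?nnegrE ?addr_ge0 ?mulr_ge0 ?invr_ge0 ?sumr_ge0 ?ler0n //.
  rewrite ler_pdivrMr // big_split /= sumr_const card_ord -mulr_sumr mulrDl.
  rewrite mulr_natr lerD2l -mulrA [m * _]mulrC.
  by rewrite ler_wpM2l.
apply: (@le_trans _ _ (((M + c * m) ^+ k) `^ k%:R^-1)).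
  by rewrite ge0_ler_powR ?nnegrE ?invr_ge0 ?exprn_ge0 ?addr_ge0 ?mulr_ge0.
rewrite -powR_mulrn ?addr_ge0 ?mulr_ge0 // -powRrM mulfV ?gt_eqF // powRr1 //.
by rewrite addr_ge0 // mulr_ge0.
Qed.

Lemma schatten_norm_fine (H : hilbertType R) (C : {linear H -> H}) p :
  1 <= p -> (schatten_norm p C < +oo)%E ->
  exists tau : R, [/\ 0 <= tau, fine (schatten_norm p C) = tau `^ p^-1 &
    forall k, \sum_(i < k) singular_value C i.+1 `^ p <= tau].
Proof.
move=> p1; rewrite /schatten_norm; set t := (\sum_(1 <= j <oo) _)%E => t_fin.
have p0 : 0 < p := lt_le_trans ltr01 p1.
have term0 j : (0 <= (singular_value C j `^ p)%:E)%E by rewrite lee_fin powR_ge0.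
have t0 : (0 <= t)%E by apply: nneseries_ge0 => j _ _; exact: term0.
have part k : ((\sum_(i < k) singular_value C i.+1 `^ p)%:E <= t)%E.
  have := @nneseries_lim_ge R (fun j => (singular_value C j `^ p)%:E) xpredT 1%N k.+1
    (fun j _ _ => term0 j).
  by rewrite big_add1 big_mkord -sumEFin.
case: t t0 t_fin part => [tau| |] //; last first.
  by move=> _; rewrite poweRyr ?invr_eq0 ?gt_eqF // ltxx.
rewrite lee_fin => tau0 _ part; exists tau; split=> //.
Qed.

End Means.

(** * The convergence bounds *)

Theorem theorem1p1 (R : realType) (H : hilbertType R)
    (A Ainv B C : {linear H -> H})
    (Hsep : separable_space H)
    (Bbd : bounded_operator B) (Binv : invertible_operator B)
    (Ccpt : compact_operator C)
    (ABC : forall x : H, A x = B x + C x)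
    (Ainvertible : bounded_inverse A Ainv)
    (MB_lt1 : reduction_factor B < 1) :
  (forall r0 : H,
    (forall k : nat, (0 < k)%N ->
      nrm (gmres_residual A r0 k) / nrm r0 <=
      \prod_(1 <= j < k.+1)
        (reduction_factor B
         + (1 + reduction_factor B) * opnorm Ainv * singular_value C j))
    /\ (limn_esup (fun k : nat => (residual_ratio A r0 k)%:E)
        <= (reduction_factor B)%:E)%E)
  /\
  (forall p : R, 1 <= p -> (schatten_norm p C < +oo)%E ->
    forall (r0 : H) (k : nat), (0 < k)%N ->
      (nrm (gmres_residual A r0 k) / nrm r0) `^ (k%:R)^-1 <=
      reduction_factor B
      + k%:R `^ (- p^-1) * (1 + reduction_factor B) * opnorm Ainv
        * fine (schatten_norm p C)).
Proof.
have [S SP] := Binv; have M0 := reduction_factor_ge0 B.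
have c0 : 0 <= (1 + reduction_factor B) * opnorm Ainv.
  by rewrite mulr_ge0 ?opnorm_ge0 // addr_ge0.
have quot_le r0 k : nrm (gmres_residual A r0 k) / nrm r0 <=
    \prod_(i < k) (reduction_factor B
         + (1 + reduction_factor B) * opnorm Ainv * singular_value C i.+1).
  have [->|r0n0] := eqVneq (nrm r0) 0.
    rewrite invr0 mulr0; apply: prodr_ge0 => i _.
    by rewrite addr_ge0 // mulr_ge0 // singular_value_ge0.
  rewrite ler_pdivrMr ?lt_def ?r0n0 ?nrm_ge0 // mulrC.
  exact: (gmres_residual_le_prod Bbd SP Ccpt ABC Ainvertible).
split=> [r0|p p1 C_fin r0 k k0].
  split=> [k _|]; first by rewrite big_add1 big_mkord.
  exact: (limn_esup_residual_ratio Bbd SP Ccpt ABC Ainvertible).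
have [tau [tau0 -> tau_ge]] := schatten_norm_fine p1 C_fin.
rewrite -[_ * _ * opnorm Ainv]mulrA.
apply: (root_prod_le (s := fun i : 'I_k => singular_value C i.+1)) => //.
- by rewrite divr_ge0 ?nrm_ge0.
- by move=> i; exact: singular_value_ge0.
Qed.
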